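(* For all $n\ge1$: (a) $\mathbf{Q}_{n+1,n}\cdot(-1)^n=\nabla e_n$; (b) $\mathbf{Q}_{n,n}\cdot(-1)^n=(-qt)^{1-n}\,\nabla\Delta_{e_1}h_n=\Delta_{e_{n-1}}e_n$, where $\cdot(-1)^n$ means applying the operator to the constant symmetric function $(-1)^n$.
   Context: Symmetric functions in $\mathbf{x}=x_1+x_2+\cdots$ over $\mathbb{Q}(q,t)$, with plethystic notation ($f[E]$: write $f$ in power sums and replace $p_k$ by $E$ with all variables raised to the $k$-th power). $M=(1-t)(1-q)$; $D_nf[\mathbf{x}]=f[\mathbf{x}+M/z]\sum_{i\ge0}(-z)^ie_i[\mathbf{x}]\big|_{z^n}$. $\widetilde H_\mu[\mathbf{x};q,t]$ are the modified Macdonald polynomials (unique basis with $\widetilde H_\mu[\mathbf{x}(1-q)]\in\mathrm{span}\{s_\lambda:\lambda\ge\mu\}$, $\widetilde H_\mu[\mathbf{x}(1-t)]\in\mathrm{span}\{s_\lambda:\lambda\ge\mu'\}$ in dominance order, $\langle\widetilde H_\mu,s_{(|\mu|)}\rangle=1$). For a partition $\mu$, $B_\mu(q,t)=\sum_{(i,j)\in\mu}t^iq^j$, summing over cells of the diagram of $\mu$ with row index $i\ge0$ and column index $j\ge0$; $T_\mu=t^{n(\mu)}q^{n(\mu')}$ with $n(\mu)=\sum_i(i-1)\mu_i$. $\nabla$ is the linear operator with $\nabla\widetilde H_\mu=T_\mu\widetilde H_\mu$, and for a symmetric function $f$, $\Delta_f$ is the linear operator with $\Delta_f\widetilde H_\mu=f[B_\mu(q,t)]\widetilde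 H_\mu$. The operators are $\mathbf{Q}_{n+1,n}=\nabla D_n\nabla^{-1}$ and $\mathbf{Q}_{n,n}=\frac{qt}{qt-1}\nabla\,\underline{h_n[\tfrac{1-qt}{qt}\mathbf{x}]}\,\nabla^{-1}$, where $\underline{g}$ denotes multiplication by $g$. *)

(* Defs.v *)
From HB Require Import structures.
From mathcomp Require Import all_boot all_order all_algebra.
From mathcomp Require Import finmap monalg.
From mathcomp Require Import ring.

Set Implicit Arguments.
Unset Strict Implicit.
Unset Printing Implicit Defensive.

Import GRing.Theory.
Local Open Scope ring_scope.

(* The field Q(q,t), as the fraction field of Q[q][t]. *)
Definition Kqt : fieldType := {fraction {poly {poly rat}}}.
Definition q : Kqt := FracField.tofrac ('X%:P : {poly {poly rat}}).
Definition t : Kqt := FracField.tofrac ('X : {poly {poly rat}}).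

(* Symmetric functions over Q(q,t) in infinitely many variables, presented as
   the polynomial ring Q(q,t)[p_1, p_2, p_3, ...] in the power sums. The
   exponent of p_k in a monomial m is m k.-1, so p is meaningful for k >= 1
   only. The lemmas e_realize and h_realize relate this presentation to
   symmetric polynomials in finitely many variables. *)
Definition Lam := {malg Kqt[{cmonom nat}]}.
HB.instance Definition _ := GRing.ComAlgebra.on Lam.

Definition p (k : nat) : Lam := << ucm k.-1 >>.

(* Plethysm. An alphabet is given by the family E of its images under raising
   all variables to the k-th power: pleth iota E f is the value of f under
   p_k |-> E k (k >= 1), coefficients being transported by iota. *)
Section Plethysm.
Context (A : comNzRingType) (iota : {rmorphism Kqt -> A}) (E : nat -> A).

Definition monom_eval (m : {cmonom nat}) : A :=
  \prod_(i <- finsupp m) E i.+1 ^+ m i.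

Lemma monom_evalEw (d : {fset nat}) (m : {cmonom nat}) :
  (finsupp m `<=` d)%fset -> monom_eval m = \prod_(i <- d) E i.+1 ^+ m i.
Proof.
move=> le; rewrite /monom_eval (big_fset_incl _ le) // => i _.
by rewrite -cmE_neq0 negbK => /eqP ->; rewrite expr0.
Qed.

Lemma monom_eval_is_mmorphism : mmorphism monom_eval.
Proof.
split=> [m1 m2|]; last by rewrite /monom_eval mdom1 big_seq_fset0.
pose d := (finsupp m1 `|` finsupp m2)%fset.
rewrite (@monom_evalEw d) ?mdomD // (@monom_evalEw d m1) ?fsubsetUl //.
rewrite (@monom_evalEw d m2) ?fsubsetUr // -big_split /=.
by apply: eq_bigr => i _; rewrite cmM exprD.
Qed.

HB.instance Definition _ :=
  isMultiplicative.Build {cmonom nat} A monom_eval monom_eval_is_mmorphism.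

Definition pleth : Lam -> A := mmap iota monom_eval.

HB.instance Definition _ := GRing.RMorphism.copy pleth (mmap iota monom_eval).

Lemma pleth_p k : (0 < k)%N -> pleth (p k) = E k.
Proof.
move=> k_gt0; rewrite /pleth mmapU /= rmorph1 mul1r /monom_eval mdomU.
by rewrite big_seq_fset1 cmUU expr1 prednK.
Qed.

Lemma plethZ c f : pleth (c *: f) = iota c * pleth f.
Proof. exact: mmapZ. Qed.
End Plethysm.

(* newton_seq eps n = [:: a_0; ...; a_n], where a_0 = 1 and, by Newton's
   identities, m a_m = \sum_(1 <= k <= m) eps^(k-1) p_k a_(m-k). *)
Fixpoint newton_seq (eps : Kqt) (n : nat) : seq Lam :=
  if n is m.+1 then
    let a := newton_seq eps m in
    rcons a ((n%:R : Kqt)^-1 *: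
      \sum_(k < n) (eps ^+ k *: p k.+1) * a`_(m - k))
  else [:: 1].

Definition h (n : nat) : Lam := (newton_seq 1 n)`_n.
Definition e (n : nat) : Lam := (newton_seq (-1) n)`_n.

Lemma size_newton_seq eps n : size (newton_seq eps n) = n.+1.
Proof. by elim: n => //= n IHn; rewrite size_rcons IHn. Qed.

Lemma nth_newton_seq eps n i :
  (i <= n)%N -> (newton_seq eps n)`_i = (newton_seq eps i)`_i.
Proof.
elim: n i => [|n IHn] i; first by rewrite leqn0 => /eqP ->.
rewrite leq_eqVlt => /orP[/eqP -> //|lt_in] /=.
by rewrite nth_rcons size_newton_seq lt_in; apply: IHn.
Qed.

Lemma natK_neq0 n : n.+1%:R != 0 :> Kqt.
Proof.
rewrite -(rmorph_nat (@FracField.tofrac {poly {poly rat}})) tofrac_eq0.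
by rewrite -!polyC_natr !polyC_eq0 Num.Theory.pnatr_eq0.
Qed.

Lemma newton_rec eps n (a := fun m => (newton_seq eps m)`_m) :
  (n.+1%:R : Kqt) *: a n.+1 =
  \sum_(k < n.+1) (eps ^+ k *: p k.+1) * a (n - k)%N.
Proof.
rewrite {1}/a /= nth_rcons size_newton_seq ltnn eqxx.
rewrite scalerA mulfV ?natK_neq0 // scale1r.
by apply: eq_bigr => k _; rewrite nth_newton_seq // leq_subr.
Qed.

Section Realization.
Context (A : comNzRingType) (iota : {rmorphism Kqt -> A}).

Definition powersums (x : seq A) (k : nat) : A := \sum_(a <- x) a ^+ k.

Lemma iota_natI n (u v : A) : n.+1%:R * u = n.+1%:R * v -> u = v.
Proof.
move=> /(congr1 ( *%R (iota n.+1%:R^-1))).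
rewrite !mulrA -(rmorph_nat iota) -rmorphM mulVf ?natK_neq0 //.
by rewrite rmorph1 !mul1r.
Qed.

Lemma newton_poly (eps : A) (x : seq A) N
    (F := \prod_(a <- x) (1 - (eps * a)%:P * 'X) : {poly A}) :
  exists R, F^`() =
    - (eps%:P * F * \poly_(k < N) (eps ^+ k * powersums x k.+1)) + R * 'X^N.
Proof.
rewrite {}/F; elim: x => [|a x [R IH]].
  exists 0; rewrite big_nil derivC mul0r addr0 poly_def big1 ?mulr0 ?oppr0 //.
  by move=> i _; rewrite /powersums big_nil mulr0 scale0r.
rewrite big_cons; set F := \prod_(_ <- x) _ in IH *.
pose G := \poly_(k < N) (eps ^+ k * powersums x k.+1).
pose b := (eps * a)%:P : {poly A}.
have -> : \poly_(k < N) (eps ^+ k * powersums (a :: x) k.+1)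
          = a%:P * \sum_(k < N) (b * 'X) ^+ k + G.
  rewrite /G !poly_def mulr_sumr -big_split /=; apply: eq_bigr => k _.
  rewrite /powersums big_cons mulrDr scalerDl; congr (_ + _).
  rewrite /b exprMn -rmorphXn /= mulrA -rmorphM /= mul_polyC; congr (_ *: _).
  by rewrite exprMn exprS; ring.
have geo := subrX1 (b * 'X) N.
rewrite derivM derivB derivC derivM derivC derivX IH -/G -/b.
exists ((1 - b * 'X) * R - b * F * b ^+ N).
rewrite exprMn in geo.
have {}geo : b ^+ N * 'X^N = 1 + (b * 'X - 1) * \sum_(i < N) (b * 'X) ^+ i.
  by rewrite -geo; ring.
have -> : ((1 - b * 'X) * R - b * F * b ^+ N) * 'X^N
        = (1 - b * 'X) * R * 'X^N
          - b * F * (1 + (b * 'X - 1) * \sum_(i < N) (b * 'X) ^+ i)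
  by rewrite -geo mulrBl !mulrA.
set S := \sum_(i < N) _.
by rewrite /b rmorphM /=; ring.
Qed.

(* e_n is the n-th elementary symmetric polynomial in any finite list x of
   variables. *)
Lemma e_realize (x : seq A) n :
  pleth iota (powersums x) (e n) = (\prod_(a <- x) (1 + a%:P * 'X))`_n.
Proof.
set F := \prod_(_ <- _) _; elim/ltn_ind: n => -[_|n IH].
  rewrite /e rmorph1 -horner_coef0 /F horner_prod big1 // => a _.
  by rewrite !hornerE.
apply: (@iota_natI n).
rewrite -{1}(rmorph_nat iota) -plethZ newton_rec rmorph_sum /=.
have [R] := @newton_poly (-1) x n.+1.
rewrite (eq_bigr (fun a => 1 + a%:P * 'X)) => [|a _]; last first.
  by rewrite mulN1r polyCN mulNr opprK.
rewrite -/F => /(congr1 (fun P : {poly A} => P`_n)).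
rewrite coef_deriv coefD coefMXn ltnSn addr0 polyCN mulN1r mulNr opprK.
move=> dF; rewrite [RHS]mulr_natl dF mulrC coefM; apply: eq_bigr => k _.
rewrite rmorphM /= plethZ pleth_p // coef_poly ltn_ord.
by rewrite IH ?ltnS ?leq_subr // rmorphXn rmorphN1.
Qed.

(* \sum_n h_n z^n is the inverse of \prod_(a <- x) (1 - a z). *)
Lemma h_realize (x : seq A) n :
  ((\prod_(a <- x) (1 - a%:P * 'X)) *
   \poly_(i < n.+1) pleth iota (powersums x) (h i))`_n = (n == 0%N)%:R.
Proof.
set F := \prod_(_ <- _) _; set Hn := \poly_(_ < _) _.
case: n @Hn => [|n] Hn.
  rewrite coef0M coef_poly /= rmorph1 mulr1 -horner_coef0 horner_prod big1 //.
  by move=> a _; rewrite !hornerE subr0.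
have [R] := @newton_poly 1 x n.+1.
rewrite (eq_bigr (fun a => 1 - a%:P * 'X)) => [|a _]; last by rewrite mul1r.
rewrite -/F mul1r; set G := \poly_(_ < _) _ => dF.
have dH k : (k <= n)%N -> Hn^`()`_k = (G * Hn)`_k.
  move=> le_kn; rewrite coef_deriv coef_poly !ltnS le_kn.
  rewrite -mulr_natl -{1}(rmorph_nat iota) -plethZ newton_rec rmorph_sum coefM.
  apply: eq_bigr => i _; rewrite rmorphM /= plethZ pleth_p //.
  rewrite !coef_poly ifT ?ifT //; first by rewrite !expr1n rmorph1.
    by rewrite (leq_ltn_trans (leq_subr _ _)) // ltnS ltnW.
  by rewrite ltnS (leq_trans _ le_kn) // -ltnS.
apply: (@iota_natI n); rewrite mulr0 mulr_natl -coef_deriv derivM dF.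
rewrite coefD mulrDl coefD -mulrA ['X^_ * _]mulrC mulrA coefMXn ltnSn addr0.
rewrite mulNr coefN -mulrA coefM [X in - X]coefM -sumrN -big_split big1 //=.
move=> i _; rewrite dH ?leq_subr // addrC.
by rewrite subrr.
Qed.
End Realization.

(* Integer partitions as weakly decreasing lists of positive integers; row i
   (counted from 0) of the diagram of mu has nth 0 mu i cells. *)
Record intpart := IntPart {
  parts :> seq nat;
  partsP : sorted geq parts && (0 \notin parts)%N }.
HB.instance Definition _ := [isSub for parts].
HB.instance Definition _ := [Choice of intpart by <:].

Definition conj_parts (mu : seq nat) : seq nat :=
  [seq count (fun m => j < m)%N mu | j <- iota 0 (head 0%N mu)].

(* dominates la mu is la >= mu in dominance order. *)
Definition dominates (la mu : seq nat) : Prop :=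
  sumn la = sumn mu /\
  forall k, (sumn (take k mu) <= sumn (take k la))%N.

(* n(mu) = \sum_i (i - 1) mu_i with parts numbered from 1. *)
Definition npart (mu : seq nat) : nat := (\sum_(i < size mu) i * nth 0 mu i)%N.

Definition T (mu : seq nat) : Kqt := t ^+ npart mu * q ^+ npart (conj_parts mu).

(* B_mu at the values q0, t0 of the parameters. *)
Definition B (mu : seq nat) (q0 t0 : Kqt) : Kqt :=
  \sum_(i < size mu) \sum_(j < nth 0%N mu i) t0 ^+ i * q0 ^+ j.

Definition plethB (f : Lam) (mu : seq nat) : Kqt :=
  pleth (A := Kqt) idfun (fun k => B mu (q ^+ k) (t ^+ k)) f.

(* Plethystic substitution of x c for c in Q(q,t), where c is given as a
   function of the parameters q and t. *)
Definition pleth_scale (c : Kqt -> Kqt -> Kqt) (f : Lam) : Lam :=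
  pleth (A := Lam) (@malgC {cmonom nat} Kqt)
    (fun k => c (q ^+ k) (t ^+ k) *: p k) f.

(* Jacobi-Trudi: det (h_(la_i - i + j)), with h_m = 0 for m < 0. *)
Definition schur (la : seq nat) : Lam :=
  \det (\matrix_(i < size la, j < size la)
    (if (i <= nth 0 la i + j)%N then h (nth 0 la i + j - i)%N else 0)).

(* Hall scalar product: <p_m, p_m'> = z_m if m = m', and 0 otherwise. *)
Definition zmon (m : {cmonom nat}) : nat :=
  (\prod_(i <- finsupp m) (i.+1 ^ m i * (m i)`!))%N.

Definition hall (f g : Lam) : Kqt :=
  \sum_(m <- msupp f) f@_m * g@_m * (zmon m)%:R.

Definition in_span (P : intpart -> Prop) (b : intpart -> Lam) (f : Lam) : Prop :=
  exists (s : seq intpart) (c : intpart -> Kqt),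
    (forall la, la \in s -> P la) /\ f = \sum_(la <- s) c la *: b la.

Definition is_basis (b : intpart -> Lam) : Prop :=
  (forall f, in_span (fun=> True) b f) /\
  (forall (s : seq intpart) (c : intpart -> Kqt), uniq s ->
     \sum_(la <- s) c la *: b la = 0 -> forall la, la \in s -> c la = 0).

Definition is_modified_macdonald (H : intpart -> Lam) : Prop :=
  [/\ is_basis H,
      forall mu : intpart, in_span (fun la => dominates la mu) schur
                   (pleth_scale (fun q0 _ => 1 - q0) (H mu)),
      forall mu : intpart, in_span (fun la => dominates la (conj_parts mu)) schur
                   (pleth_scale (fun _ t0 => 1 - t0) (H mu))
    & forall mu : intpart, hall (H mu) (schur [:: sumn mu]) = 1].

Definition is_nabla (H : intpart -> Lam) (L : Lam -> Lam) : Prop :=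
  forall mu : intpart, L (H mu) = T mu *: H mu.

Definition is_Delta (H : intpart -> Lam) (f : Lam) (L : Lam -> Lam) : Prop :=
  forall mu : intpart, L (H mu) = plethB f mu *: H mu.

Definition M (q0 t0 : Kqt) : Kqt := (1 - t0) * (1 - q0).

(* f[x + M/z], as a polynomial in the indeterminate 1/z. *)
Definition pleth_Mz (f : Lam) : {poly Lam} :=
  pleth (A := {poly Lam}) (polyC \o @malgC {cmonom nat} Kqt)
    (fun k => (p k)%:P + (M (q ^+ k) (t ^+ k))%:MP%:P * 'X^k) f.

(* The coefficient of z^n in f[x + M/z] \sum_i (-z)^i e_i: the term z^(-j) of
   the first factor meets the term i = n + j of the second. *)
Definition D (n : nat) (f : Lam) : Lam :=
  \sum_(j < size (pleth_Mz f)) (pleth_Mz f)`_j * ((-1) ^+ (n + j) * e (n + j)).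

(* In the next two definitions nablaV stands for the inverse of nabla. *)
Definition Qsucc (nabla nablaV : Lam -> Lam) (n : nat) (f : Lam) : Lam :=
  nabla (D n (nablaV f)).

Definition Qdiag (nabla nablaV : Lam -> Lam) (n : nat) (f : Lam) : Lam :=
  (q * t / (q * t - 1)) *:
    nabla (pleth_scale (fun q0 t0 => (1 - q0 * t0) / (q0 * t0)) (h n)
           * nablaV f).

(* Main.v *)
Require Import Defs.
From HB Require Import structures.
From mathcomp Require Import all_boot all_order all_algebra.
From mathcomp Require Import finmap monalg.
From mathcomp Require Import perm ring zify.

Set Implicit Arguments.
Unset Strict Implicit.
Unset Printing Implicit Defensive.

Import GRing.Theory.
Local Open Scope ring_scope.

(* With M' = (1 - 1/q)(1 - 1/t), the operator D_0 and its dual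
     D_0^* f = f[x - M'/z] \sum_i z^i h_i[x] |_(z^0)
   are diagonal on the modified Macdonald basis, with eigenvalues
   1 - M B_mu(q,t) and 1 - M' B_mu(1/q,1/t).  Indeed, conjugating either one by
   p_k |-> (1 - q^k) p_k, or by p_k |-> (1 - t^k) p_k, gives a Macdonald
   operator that is triangular on the products h_la for the dominance order, and
   the two triangularity conditions that define H_mu only leave the line of H_mu,
   as conjugation of partitions reverses dominance.

   Applying D_0 to h_n and D_0^* to e_n is elementary and expresses both
   Delta_(e_1) h_n and nabla^-1 Delta_(e_(n-1)) e_n as multiples of
   h_n[(1 - qt) x]; for the latter, e_(n-1)[B_mu] = T_mu B_mu(1/q,1/t) when
   |mu| = n.  And Q_(n,n) (-1)^n is a multiple of nabla h_n[(1 - qt) x] by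
   definition. *)

Lemma q_exp_neq1 n : q ^+ n.+1 != 1.
Proof.
rewrite -tofracXn -tofrac1 tofrac_eq -polyC_exp; apply/eqP => /polyC_inj.
move=> /(congr1 (fun P : {poly _} => size P)).
by rewrite size_polyXn size_poly1.
Qed.

Lemma t_exp_neq1 n : t ^+ n.+1 != 1.
Proof.
rewrite -tofracXn -tofrac1 tofrac_eq; apply/eqP.
move=> /(congr1 (fun P : {poly _} => size P)).
by rewrite size_polyXn size_poly1.
Qed.

Lemma q_neq0 : q != 0.
Proof. by rewrite tofrac_eq0 polyC_eq0 polyX_eq0. Qed.

Lemma t_neq0 : t != 0.
Proof. by rewrite tofrac_eq0 polyX_eq0. Qed.

Lemma qt_neq1 : q * t != 1.
Proof.
rewrite -tofracM -tofrac1 tofrac_eq;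
  apply/eqP => /(congr1 (fun P : {poly _} => P`_0)).
by rewrite coefMX coef1 => /eqP; rewrite eq_sym oner_eq0.
Qed.

(** * Plethystic evaluation of the complete symmetric functions *)

(* Sealed copies of p and h: attempts to unify their unfoldings explode. *)
HB.lock Definition psum (k : nat) : Lam := p k.
HB.lock Definition hsym (n : nat) : Lam := h n.

Lemma psumE k : psum k = p k. Proof. by rewrite psum.unlock. Qed.

Lemma hsymE n : hsym n = h n. Proof. by rewrite hsym.unlock. Qed.

Lemma Lam_ind (P : Lam -> Prop) :
  (forall c, P c%:MP) -> (forall f g, P f -> P g -> P (f + g)) ->
  (forall f g, P f -> P g -> P (f * g)) -> (forall k, P (psum k.+1)) ->
  forall f, P f.
Proof.
move=> PC PD PM Pp f; rewrite (monalgE f); apply: big_ind => [|//|m _].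
  by have := PC 0; rewrite raddf0.
have -> : << f@_m *g m >> = (f@_m)%:MP * << m >> :> Lam.
  by rewrite malgM_def fgmulUU mulr1 mul1m.
apply: (PM) => //.
have [d led] : exists d, (mdeg m <= d)%N by exists (mdeg m).
elim: d m led => [|d IHd] m led.
  have -> : m = mone by apply: mdeg_eq0I; apply/eqP; rewrite -leqn0.
  by have := PC 1.
have [m0|mn0] := eqVneq (mdeg m) 0; first by apply: IHd; rewrite m0.
have [i im] : exists i, i \in finsupp m.
  by apply/fset0Pn; apply: contra_neq mn0 => m0; rewrite mdegE m0 big_seq_fset0.
have -> : << m >> = psum i.+1 * << divcm m (ucm i) >> :> Lam.
  rewrite psumE /p /= malgM_def fgmulUU mulr1; congr << _ >>.
  apply/eqP/cmP => j; rewrite cmM divcmE cmU subnKC //.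
  by case: eqVneq => // <-; rewrite lt0n cmE_neq0.
apply: (PM) => //; apply: IHd.
rewrite -ltnS (leq_trans _ led) //.
have {2}-> : m = mmul (ucm i) (divcm m (ucm i)).
  apply/eqP/cmP => j; rewrite cmM divcmE cmU subnKC //.
  by case: eqVneq => // <-; rewrite lt0n cmE_neq0.
by rewrite mdegM mdegU add1n.
Qed.

Lemma Lam_ext (A : comNzRingType) (F G : {rmorphism Lam -> A}) :
  (forall c, F c%:MP = G c%:MP) -> (forall k, F (psum k.+1) = G (psum k.+1)) ->
  F =1 G.
Proof.
move=> FGC FGp; elim/Lam_ind => // f g Ff Fg.
  by rewrite !rmorphD /= Ff Fg.
by rewrite !rmorphM /= Ff Fg.
Qed.

Section NewtonSequences.
Context (A : comNzRingType) (iota : {rmorphism Kqt -> A}).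
Implicit Types E : nat -> A.

Lemma plethC E c : pleth iota E c%:MP = iota c.
Proof. exact: mmapC. Qed.

Lemma pleth_psum E k : (0 < k)%N -> pleth iota E (psum k) = E k.
Proof. by rewrite psumE; apply: pleth_p. Qed.

Lemma pleth_ext E E' : (forall k, E k.+1 = E' k.+1) ->
  pleth iota E =1 pleth iota E'.
Proof.
move=> EE'; apply: Lam_ext => [c|k] /=; first by rewrite !plethC.
by rewrite !pleth_psum //.
Qed.

Lemma pleth_h0 E : pleth iota E (hsym 0) = 1.
Proof. by rewrite hsymE; apply: rmorph1. Qed.

Lemma hsym0 : hsym 0 = 1.
Proof. by rewrite hsymE. Qed.

Lemma pleth_hS E n : n.+1%:R * pleth iota E (hsym n.+1) =
  \sum_(k < n.+1) E k.+1 * pleth iota E (hsym (n - k)%N).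
Proof.
rewrite hsymE -(rmorph_nat iota) -plethZ newton_rec rmorph_sum.
by apply: eq_bigr => k _; rewrite rmorphM /= plethZ pleth_p // hsymE expr1n
  rmorph1 mul1r.
Qed.

Lemma newton_uniq E (a : nat -> A) : a 0%N = 1 ->
  (forall n, n.+1%:R * a n.+1 = \sum_(k < n.+1) E k.+1 * a (n - k)%N) ->
  forall n, a n = pleth iota E (hsym n).
Proof.
move=> a0 aS n; elim/ltn_ind: n => -[_|n IHn]; first by rewrite a0 pleth_h0.
apply: (@iota_natI _ iota n); rewrite aS pleth_hS.
by apply: eq_bigr => k _; rewrite IHn // ltnS leq_subr.
Qed.

Lemma pleth_hD E E' n : pleth iota (fun k => E k + E' k) (hsym n) =
  \sum_(i < n.+1) pleth iota E (hsym i) * pleth iota E' (hsym (n - i)%N).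
Proof.
symmetry; move: n; apply: newton_uniq => [|n].
  by rewrite big_ord1 !pleth_h0 mul1r.
pose N := n.+2.
pose S E := \poly_(k < N) E k.+1.
pose P E := \poly_(k < N) pleth iota E (hsym k).
have coefPM m : (m < N)%N -> (P E * P E')`_m =
    \sum_(i < m.+1) pleth iota E (hsym i) * pleth iota E' (hsym (m - i)%N).
  move=> lt_m; rewrite coefM; apply: eq_bigr => i _; rewrite !coef_poly.
  have le_im : (i <= m)%N by rewrite -ltnS.
  by rewrite (leq_ltn_trans le_im lt_m) (leq_ltn_trans (leq_subr _ _) lt_m).
have dP F m : (m <= n)%N -> (P F)^`()`_m = (S F * P F)`_m.
  move=> le_m; rewrite coef_deriv coef_poly /N !ltnS le_m -mulr_natl pleth_hS
    coefM.
  apply: eq_bigr => k _; rewrite !coef_poly /N.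
  have lt_m : (m < N)%N by rewrite /N ltnS (leq_trans le_m).
  rewrite (leq_ltn_trans _ lt_m) ?(leq_ltn_trans (leq_subr _ _) lt_m) //.
  by rewrite -ltnS.
rewrite -coefPM // mulr_natl -coef_deriv derivM coefD.
have -> : ((P E)^`() * P E')`_n = (S E * (P E * P E'))`_n.
  rewrite mulrA [LHS]coefM [RHS]coefM; apply: eq_bigr => k _.
  by rewrite dP // -ltnS.
have -> : (P E * (P E')^`())`_n = (S E' * (P E * P E'))`_n.
  rewrite mulrCA [LHS]coefM [RHS]coefM; apply: eq_bigr => k _.
  by rewrite dP // leq_subr.
rewrite !coefM -big_split; apply: eq_bigr => k _ /=.
rewrite !coef_poly /N (leq_trans (ltn_ord k)) // -mulrDl coefPM //.
by rewrite (leq_ltn_trans (leq_subr _ _)).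
Qed.

Lemma pleth_hM (c : A) E n :
  pleth iota (fun k => c ^+ k * E k) (hsym n) = c ^+ n * pleth iota E (hsym n).
Proof.
symmetry; move: n; apply: newton_uniq => [|n].
  by rewrite pleth_h0 expr0 mulr1.
rewrite mulrCA pleth_hS mulr_sumr; apply: eq_bigr => k _.
rewrite mulrACA -exprD; congr (c ^+ _ * _).
by rewrite addSn subnKC // -ltnS.
Qed.

Lemma pleth_h_unit n : pleth iota (fun=> 1) (hsym n) = 1.
Proof.
symmetry; apply: (@newton_uniq _ (fun=> 1)) => // {}n.
rewrite mulr1 (eq_bigr (fun=> 1)) => [|k _]; last by rewrite mulr1.
by rewrite sumr_const card_ord.
Qed.

Lemma pleth_h_zero n : pleth iota (fun=> 0) (hsym n) = (n == 0%N)%:R.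
Proof.
symmetry; apply: (@newton_uniq _ (fun n => (n == 0%N)%:R)) => // {}n.
by rewrite mulr0 big1 // => k _; rewrite mul0r.
Qed.

Lemma pleth_hB (c : A) E n :
  pleth iota (fun k => E k - c ^+ k) (hsym n.+1) =
  pleth iota E (hsym n.+1) - c * pleth iota E (hsym n).
Proof.
have hE m : pleth iota E (hsym m) =
    \sum_(i < m.+1) pleth iota (fun k => E k - c ^+ k) (hsym i) * c ^+ (m - i).
  rewrite (@pleth_ext _ (fun k => (E k - c ^+ k) + c ^+ k * 1)); last first.
    by move=> k; rewrite mulr1 subrK.
  by rewrite pleth_hD; apply: eq_bigr => i _;
    rewrite pleth_hM pleth_h_unit mulr1.
rewrite hE big_ord_recr /= subnn mulr1 hE mulr_sumr addrAC -sumrB big1 ?add0r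
  //.
by move=> i _; rewrite mulrCA -exprS subSn ?subrr ?leq_ord.
Qed.

Lemma pleth_e E n :
  pleth iota E (e n) = (-1) ^+ n * pleth iota (fun k => - E k) (hsym n).
Proof.
suff <- : (-1) ^+ n * pleth iota E (e n) = pleth iota (fun k => - E k) (hsym n).
  by rewrite mulrA -exprMn mulrNN mulr1 expr1n mul1r.
move: n; apply: newton_uniq => [|n].
  by rewrite /e rmorph1 mulr1.
rewrite mulrCA -[X in _ * (X * _)](rmorph_nat iota) -plethZ newton_rec.
rewrite rmorph_sum mulr_sumr; apply: eq_bigr => k _; rewrite rmorphM /= plethZ.
rewrite pleth_p // rmorphXn rmorphN1 -/(e _).
have -> : (-1) ^+ n.+1 = - ((-1) ^+ k * (-1) ^+ (n - k)) :> A.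
  by rewrite -exprD subnKC ?leq_ord // exprS mulN1r.
have sk : (-1) ^+ k * (-1) ^+ k = 1 :> A by rewrite -exprMn mulrNN mulr1 expr1n.
rewrite !mulNr; congr (- _); move: (pleth _ _ _) => x.
move: (_ ^+ k) (_ ^+ (n - k)) (E _) sk => u v y sk.
by rewrite -[RHS]mul1r -sk; ring.
Qed.
End NewtonSequences.

Inductive lspan (K : fieldType) (V : lmodType K) (X : V -> Prop) : V -> Prop :=
| lspan0 : lspan X 0
| lspan_cons c v f : X v -> lspan X f -> lspan X (c *: v + f).

Section LSpan.
Context (K : fieldType) (V : lmodType K).
Implicit Types (X Y : V -> Prop) (f g u v : V).

Lemma lspanD X f g : lspan X f -> lspan X g -> lspan X (f + g).
Proof.
move=> Xf Xg; elim: Xf => [|c v {}f Xv _ IH]; first by rewrite add0r.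
by rewrite -addrA; apply: lspan_cons.
Qed.

Lemma lspanZ X c f : lspan X f -> lspan X (c *: f).
Proof.
elim=> [|d v {}f Xv _ IH]; first by rewrite scaler0; apply: lspan0.
by rewrite scalerDr scalerA; apply: lspan_cons.
Qed.

Lemma lspanN X f : lspan X f -> lspan X (- f).
Proof. by rewrite -scaleN1r; apply: lspanZ. Qed.

Lemma lspan_gen X v : X v -> lspan X v.
Proof.
by move=> Xv; rewrite -[v]addr0 -[v]scale1r; apply/lspan_cons/lspan0.
Qed.

Lemma lspan_sum X I (r : seq I) (P : pred I) (F : I -> V) :
  (forall i, P i -> lspan X (F i)) -> lspan X (\sum_(i <- r | P i) F i).
Proof.
by move=> XF; apply: big_ind => //; [apply: lspan0 | move=> f g; apply: lspanD].
Qed.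

End LSpan.

Lemma lspan_map (K : fieldType) (V W : lmodType K) (X : V -> Prop) (Y :
  W -> Prop) (F : V -> W) :
    F 0 = 0 -> (forall c f g, F (c *: f + g) = c *: F f + F g) ->
    (forall v, X v -> lspan Y (F v)) ->
  forall f, lspan X f -> lspan Y (F f).
Proof.
move=> F0 Flin XY f; elim=> [|c v {}f Xv _ IH]; first by rewrite F0;
  apply: lspan0.
by rewrite Flin; apply: lspanD => //; apply/lspanZ/XY.
Qed.

Lemma lspan_trans (K : fieldType) (V : lmodType K) (X Y : V -> Prop) :
  (forall v, X v -> lspan Y v) ->
  forall f, lspan X f -> lspan Y f.
Proof. exact: (@lspan_map K V V X Y id). Qed.

Lemma lspan_mull (K : fieldType) (A : algType K) (X Y : A -> Prop) u :
  (forall v, X v -> Y (u * v)) -> forall f, lspan X f -> lspan Y (u * f).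
Proof.
move=> XY; apply: (@lspan_map K A A X Y ( *%R u)) => [|c f g|v Xv].
- exact: mulr0.
- by rewrite mulrDr scalerAr.
by apply/lspan_gen/XY.
Qed.

(* [scale g] is p_k |-> g_k p_k; thus [scale g (hsym n)] is h_n[g x]. *)
Definition scale (g : nat -> Kqt) : Lam -> Lam :=
  pleth (A := Lam) (@malgC {cmonom nat} Kqt) (fun k => g k *: psum k).

HB.instance Definition _ g := GRing.RMorphism.copy (scale g)
  (pleth (A := Lam) (@malgC {cmonom nat} Kqt) (fun k => g k *: psum k)).

Section Scale.
Implicit Types g : nat -> Kqt.

Lemma scaleC g c : scale g c%:MP = c%:MP.
Proof. exact: plethC. Qed.

Lemma scale_p g k : scale g (psum k.+1) = g k.+1 *: psum k.+1.
Proof. by rewrite /scale pleth_psum //. Qed.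

Lemma scaleZ g c f : scale g (c *: f) = c *: scale g f.
Proof. by rewrite /scale plethZ mul_malgC. Qed.

Lemma scale_ext g g' : (forall k, g k.+1 = g' k.+1) -> scale g =1 scale g'.
Proof. by move=> eqg; apply: pleth_ext => k; rewrite eqg. Qed.

Lemma scale_unit f : scale (fun=> 1) f = f.
Proof.
apply: (@Lam_ext _ (scale (fun=> 1)) idfun) => [c|k] /=;
  first by rewrite scaleC.
by rewrite scale_p scale1r.
Qed.

Lemma scale_comp g g' f : scale g (scale g' f) = scale (fun k => g k * g' k) f.
Proof.
apply: (@Lam_ext _ (scale g \o scale g') (scale _)) => [c|k] /=.
  by rewrite !scaleC.
by rewrite !scale_p scaleZ scale_p scalerA mulrC.
Qed.

Lemma scale_hD g g' n : scale (fun k => g k + g' k) (hsym n) =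
  \sum_(i < n.+1) scale g (hsym i) * scale g' (hsym (n - i)%N).
Proof.
by rewrite /scale -pleth_hD; apply: pleth_ext => k; rewrite scalerDl.
Qed.

Lemma scale_hM c g n :
  scale (fun k => c ^+ k * g k) (hsym n) = c ^+ n *: scale g (hsym n).
Proof.
rewrite -[RHS]mul_malgC rmorphXn /scale -pleth_hM; apply: pleth_ext => k.
by rewrite -scalerA -mul_malgC rmorphXn.
Qed.

Lemma scale_h_pow c n : scale (fun k => c ^+ k) (hsym n) = c ^+ n *: hsym n.
Proof.
rewrite -[hsym n in RHS]scale_unit -scale_hM.
by apply: scale_ext => k; rewrite mulr1.
Qed.

Lemma scale_h_zero n : scale (fun=> 0) (hsym n) = (n == 0%N)%:R.
Proof.
by rewrite -(@pleth_h_zero _ (@malgC {cmonom nat} Kqt));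
  apply: pleth_ext => k; rewrite scale0r.
Qed.

Lemma e_scale_h n : e n = (-1) ^+ n *: scale (fun=> -1) (hsym n).
Proof.
have := pleth_e (@malgC {cmonom nat} Kqt) (fun k => 1 *: psum k) n.
rewrite -/(scale (fun=> 1) _) scale_unit -mul_malgC => ->.
rewrite rmorphXn rmorphN1 -(@pleth_ext _ _ (fun k => -1 *: psum k)) // => k.
by rewrite scaleN1r scale1r.
Qed.
End Scale.

(* [shift al f] is f[x + al / z], as a polynomial in 1/z. *)
Definition shift (al : nat -> Kqt) : Lam -> {poly Lam} :=
  pleth (A := {poly Lam}) (polyC \o @malgC {cmonom nat} Kqt)
    (fun k => (psum k)%:P + (al k)%:MP%:P * 'X^k).

HB.instance Definition _ al := GRing.RMorphism.copy (shift al)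
  (pleth (A := {poly Lam}) (polyC \o @malgC {cmonom nat} Kqt)
    (fun k => (psum k)%:P + (al k)%:MP%:P * 'X^k)).

Section Shift.
Implicit Types al g be : nat -> Kqt.

Lemma shiftC al c : shift al c%:MP = c%:MP%:P.
Proof. exact: plethC. Qed.

Lemma shift_p al k : shift al (psum k.+1) =
  (psum k.+1)%:P + (al k.+1)%:MP%:P * 'X^(k.+1).
Proof. by rewrite /shift pleth_psum //. Qed.

Lemma shiftZ al c f : shift al (c *: f) = c%:MP%:P * shift al f.
Proof. exact: plethZ. Qed.

Lemma shift_coef0 al f : (shift al f)`_0 = f.
Proof.
rewrite -horner_coef0 -/(horner_eval 0 _).
apply: (@Lam_ext _ (horner_eval 0 \o shift al) idfun) => [c|k] /=.
  by rewrite shiftC /horner_eval hornerC.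
by rewrite shift_p /horner_eval hornerD hornerM hornerXn expr0n mulr0 addr0
  hornerC.
Qed.

Lemma coef_shift_h al g n i : (shift al (scale g (hsym n)))`_i =
  if (i <= n)%N then pleth (A := Kqt) idfun (fun k => g k * al k) (hsym i)
                     *: scale g (hsym (n - i)) else 0.
Proof.
pose io := polyC \o @malgC {cmonom nat} Kqt : {rmorphism Kqt -> {poly Lam}}.
have -> : shift al (scale g (hsym n)) =
    pleth io (fun k => 'X^k * (io (g k) * io (al k)) + io (g k) * (psum k)%:P)
      (hsym n).
  apply: (@Lam_ext _ (shift al \o scale g)) => [c|k] /=.
    by rewrite scaleC shiftC plethC.
  rewrite scale_p shiftZ shift_p pleth_psum // mulrDr addrC; congr (_ + _).
  by rewrite mulrA mulrC.
rewrite pleth_hD coef_sum.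
have hX j : pleth io (fun k => 'X^k * (io (g k) * io (al k))) (hsym j) =
    'X^j * io (pleth (A := Kqt) idfun (fun k => g k * al k) (hsym j)).
  rewrite pleth_hM; congr (_ * _).
  apply: (@Lam_ext _ _ (io \o pleth _ _)) => [c|k]; first by rewrite /= !plethC.
  transitivity (io (g k.+1) * io (al k.+1)); first exact: pleth_psum.
  by rewrite -rmorphM; congr (io _); symmetry; apply: pleth_psum.
have hC j : pleth io (fun k =>
  io (g k) * (psum k)%:P) (hsym j) = (scale g (hsym j))%:P.
  apply: (@Lam_ext _ _ (polyC \o scale g)) => [c|k] /=.
    by rewrite plethC scaleC.
  by rewrite scale_p pleth_psum // /io /= -polyCM mul_malgC.
have cf (j : 'I_n.+1) : true -> (pleth io (fun k =>
  'X^k * (io (g k) * io (al k))) (hsym j) *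
      pleth io (fun k => io (g k) * (psum k)%:P) (hsym (n - j)%N))`_i =
   if i == j then pleth (A := Kqt) idfun (fun k => g k * al k) (hsym i)
                     *: scale g (hsym (n - i)) else 0.
  move=> _; rewrite hX hC -mulrA mulrC -polyCM coefCM coefXn.
  by case: eqVneq => [->|_]; rewrite ?mulr0 // mulr1 mul_malgC.
rewrite (eq_bigr _ cf) -big_mkcond /=.
case: leqP => [le_in|lt_ni];
  first by rewrite (big_pred1 (inord i)) // => j /=;
    rewrite -val_eqE /= inordK // eq_sym.
by rewrite big1 // => j /eqP ij; move: (ltn_ord j) lt_ni; rewrite -ij; lia.
Qed.

End Shift.

Lemma map_binomial (A : comNzRingType) (phi : {rmorphism A -> A}) (x b : A) k :
  map_poly phi (x%:P + b%:P * 'X^k) = (phi x)%:P + (phi b)%:P * 'X^k.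
Proof. by rewrite rmorphD rmorphM /= !map_polyC map_polyXn. Qed.

Lemma comp_binomial (A : comNzRingType) (x b c : A) k :
  (x%:P + b%:P * 'X^k) \Po (c%:P * 'X) = x%:P + (b * c ^+ k)%:P * 'X^k.
Proof.
rewrite comp_polyD comp_polyM !comp_polyC comp_Xn_poly exprMn -rmorphXn /=.
by rewrite mulrA polyCM.
Qed.

(** * Vertex operators *)

Section VCoef.
Context (R : comNzRingType).

(* With F a polynomial in 1/z, the coefficient of z^-j in F \sum_i z^i g_i. *)
Definition vcoef (g : nat -> R) (j : nat) (F : {poly R}) : R :=
  \sum_(s < size F) F`_s * (if (j <= s)%N then g (s - j)%N else 0).

Variable g : nat -> R.

Lemma vcoefEw N j (F : {poly R}) : (size F <= N)%N ->
  vcoef g j F = \sum_(s < N) F`_s * (if (j <= s)%N then g (s - j)%N else 0).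
Proof.
move=> le_FN; rewrite /vcoef (big_ord_widen N (fun s =>
  F`_s * (if (j <= s)%N then g (s - j)%N else 0)) le_FN) big_mkcond /=.
by apply: eq_bigr => s _; case: ltnP => // le_Fs; rewrite nth_default ?mul0r.
Qed.

Lemma vcoefD j (F G : {poly R}) : vcoef g j (F + G) = vcoef g j F + vcoef g j G.
Proof.
pose N := maxn (size F) (size G).
rewrite !(@vcoefEw N) ?leq_maxl ?leq_maxr ?size_polyD // -big_split /=.
by apply: eq_bigr => s _; rewrite coefD mulrDl.
Qed.

Lemma vcoefCM j u (F : {poly R}) : vcoef g j (u%:P * F) = u * vcoef g j F.
Proof.
rewrite !(@vcoefEw (size F)) // ?mulr_sumr.
  by apply: eq_bigr => s _; rewrite coefCM mulrA.
by rewrite mul_polyC size_scale_leq.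
Qed.

Lemma vcoef_sum j I (r : seq I) (F : I -> {poly R}) :
  vcoef g j (\sum_(i <- r) F i) = \sum_(i <- r) vcoef g j (F i).
Proof.
apply: (big_morph _ (vcoefD j)).
by rewrite /vcoef size_poly0 big_ord0.
Qed.

Lemma vcoefXM j i N (F : {poly R}) : (size F <= N)%N -> vcoef g j ('X^i * F) =
  \sum_(s < N) F`_s * (if (j <= i + s)%N then g (i + s - j)%N else 0).
Proof.
move=> le_FN; rewrite (@vcoefEw (i + N)).
  rewrite big_split_ord /= big1 ?add0r => [|s _].
    by apply: eq_bigr => s _; rewrite coefXnM ltnNge leq_addr addKn.
  by rewrite coefXnM ltn_ord mul0r.
rewrite (leq_trans (size_polyMleq _ _)) // size_polyXn addSn /=.
by rewrite leq_add2l.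
Qed.

(* Summed against h_(m-i), the coefficients of a full vertex operator form a
   convolution, whose terms with negative i are moved to the other side. *)
Lemma vcoef_conv (hh ah : nat -> R) :
  (forall n, \sum_(r < n.+1) g r * hh (n - r)%N = ah n) ->
  forall j m N (G : {poly R}), (size G <= N)%N ->
  \sum_(i < m.+1) hh (m - i)%N * vcoef g j ('X^i * G) =
  \sum_(s < N) G`_s * (if (j <= m + s)%N then ah (m + s - j)%N else 0)
  - \sum_(i < N) hh (m + i.+1)%N * vcoef g (j + i.+1) G.
Proof.
move=> conv j m N G le_GN.
pose gz j s := if (j <= s)%N then g (s - j)%N else 0.
have -> : \sum_(i < m.+1) hh (m - i)%N * vcoef g j ('X^i * G) =
    \sum_(s < N) G`_s * \sum_(i < m.+1) hh (m - i)%N * gz j (i + s)%N.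
  under eq_bigr do rewrite (vcoefXM _ _ le_GN) mulr_sumr.
  rewrite exchange_big /=; apply: eq_bigr => s _; rewrite mulr_sumr.
  by apply: eq_bigr => i _; rewrite mulrCA.
have -> : \sum_(i < N) hh (m + i.+1)%N * vcoef g (j + i.+1) G =
    \sum_(s < N) G`_s * \sum_(i < N) hh (m + i.+1)%N * gz (j + i.+1)%N s.
  under eq_bigr do rewrite (vcoefEw _ le_GN) mulr_sumr.
  rewrite exchange_big /=; apply: eq_bigr => s _; rewrite mulr_sumr.
  by apply: eq_bigr => i _; rewrite mulrCA.
rewrite -sumrB; apply: eq_bigr => s _; rewrite -mulrBr; congr (_ * _).
case: (leqP j s) => [le_js|lt_sj].
  rewrite (leq_trans le_js (leq_addl _ _)) -addnBA // -conv addnC -addnS.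
  set d := (s - j)%N.
  rewrite big_split_ord /= [X in X + _ - _](_ : _ =
      \sum_(i < N) hh (m + i.+1)%N * gz (j + i.+1)%N s); last first.
    rewrite [RHS](bigID (fun i : 'I_N => (i < d)%N)) /= [X in _ + X]big1 ?addr0.
      have le_dN : (d <= N)%N by rewrite (leq_trans (leq_subr _ _)) // ltnW.
      rewrite -(big_ord_widen _ (fun i =>
        hh (m + i.+1)%N * gz (j + i.+1)%N s) le_dN).
      rewrite (reindex_inj rev_ord_inj) /=; apply: eq_bigr => i _.
      have lt_id := ltn_ord i.
      rewrite /gz ifT; last by rewrite -leq_subRL // addnS; lia.
      rewrite mulrC; congr (hh _ * g _); rewrite /d in lt_id *; lia.
    move=> i /negPf ni; rewrite /gz ifF ?mulr0 //.
    by apply/negP => H; move: ni; rewrite /d => /negP []; lia.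
  rewrite addrC addKr; apply: eq_bigr => i _.
  rewrite /gz ifT; last by rewrite (leq_trans le_js) // leq_addl.
  have lt_im := ltn_ord i.
  rewrite mulrC; congr (g _ * hh _); rewrite /d; lia.
rewrite [X in _ - X]big1 ?subr0; last first.
  by move=> i _; rewrite /gz ifF ?mulr0 //; apply/negP; lia.
case: (leqP j (m + s)) => [le_j|gt_j]; last first.
  rewrite big1 // => i _; have lt_im := ltn_ord i.
  by rewrite /gz ifF ?mulr0 //; apply/negP; lia.
rewrite -conv (_ : m.+1 = (j - s) + (m + s - j).+1)%N; last lia.
rewrite big_split_ord /= big1 ?add0r => [|i _].
  apply: eq_bigr => i _; have lt_i := ltn_ord i.
  rewrite /gz ifT; last lia.
  by rewrite mulrC; congr (g _ * hh _); lia.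
have lt_i := ltn_ord i.
by rewrite /gz ifF ?mulr0 //; apply/negP; lia.
Qed.
End VCoef.

Lemma rmorph_vcoef (R : comNzRingType) (phi : {rmorphism R -> R}) g g' (F G :
  {poly R}) :
  (forall s, phi F`_s * phi (g s) = G`_s * g' s) ->
  phi (vcoef g 0 F) = vcoef g' 0 G.
Proof.
move=> FG; pose N := maxn (size F) (size G).
rewrite !(@vcoefEw _ _ N) ?leq_maxl ?leq_maxr // rmorph_sum.
by apply: eq_bigr => s _; rewrite rmorphM /= subn0.
Qed.

(* [vertex al be j f] is the coefficient of z^-j in
   f[x + al / z] \sum_i z^i h_i[be x]. *)
Definition vertex (al be : nat -> Kqt) (j : nat) (f : Lam) : Lam :=
  vcoef (fun i => scale be (hsym i)) j (shift al f).

Section Vertex.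
Implicit Types al be g : nat -> Kqt.

Lemma vertexD al be j f f' :
  vertex al be j (f + f') = vertex al be j f + vertex al be j f'.
Proof. by rewrite /vertex rmorphD vcoefD. Qed.

Lemma vertexZ al be j c f : vertex al be j (c *: f) = c *: vertex al be j f.
Proof. by rewrite /vertex shiftZ vcoefCM mul_malgC. Qed.

Lemma vertex0 al be j : vertex al be j 0 = 0.
Proof. by rewrite -[X in vertex _ _ _ X](scale0r 0) vertexZ scale0r. Qed.

Lemma vertex1 al be : vertex al be 0 1 = 1.
Proof.
rewrite /vertex rmorph1 /vcoef size_poly1 big_ord1 coef1 mul1r /=.
by rewrite hsym0 rmorph1.
Qed.

Lemma vertex_ext al be al' be' j f :
  (forall k, al k.+1 = al' k.+1) -> (forall k, be k.+1 = be' k.+1) ->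
  vertex al be j f = vertex al' be' j f.
Proof.
move=> eqal eqbe; rewrite /vertex.
have -> : shift al f = shift al' f by apply: pleth_ext => k; rewrite eqal.
by apply: eq_bigr => s _; rewrite (scale_ext eqbe).
Qed.

Lemma scale_coef_shift al g c f i :
  scale g (shift (fun k => al k * g k * c ^+ k) f)`_i =
  c ^+ i *: (shift al (scale g f))`_i.
Proof.
pose cX : {poly Lam} := c%:MP%:P * 'X.
rewrite -coef_map.
have -> : map_poly (scale g) (shift (fun k => al k * g k * c ^+ k) f) =
    shift al (scale g f) \Po cX.
  apply: (@Lam_ext _ (map_poly (scale g) \o shift _)
           (comp_poly cX \o (shift al \o scale g))) => [a|k] /=.
    by rewrite !shiftC scaleC shiftC comp_polyC map_polyC /= scaleC.
  rewrite shift_p scale_p shiftZ shift_p.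
  have mapE x b : map_poly (scale g) (x%:P + b%:P * 'X^(k.+1)) =
      (scale g x)%:P + (scale g b)%:P * 'X^(k.+1) by exact: map_binomial.
  rewrite mapE comp_polyM comp_polyC comp_binomial mulrDr.
  congr (_ + _); first by rewrite scale_p -mul_malgC polyCM.
  rewrite mulrA -polyCM; congr (_%:P * _).
  rewrite scaleC [al _ * _]mulrC -mulrA.
  by rewrite rmorphM rmorphM rmorphXn.
rewrite coef_comp_poly.
have cf (j : nat) : (cX ^+ j)`_i = if i == j then (c ^+ i)%:MP else 0.
  rewrite exprMn -rmorphXn /= -rmorphXn /= coefCM coefXn.
  by case: eqVneq => [->|_]; rewrite ?mulr1 ?mulr0.
under eq_bigr do rewrite cf.
case: (ltnP i (size (shift al (scale g f)))) => [lt_i|le_i].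
  rewrite (bigD1 (Ordinal lt_i)) //= eqxx big1 ?addr0 => [|j nj].
    by rewrite mulrC mul_malgC.
  by rewrite -val_eqE /= eq_sym in nj; rewrite (negPf nj) mulr0.
rewrite nth_default // scaler0 big1 // => j _.
by rewrite gtn_eqF ?mulr0 // (leq_trans (ltn_ord j)).
Qed.

Lemma scale_vertex al be g c f :
  scale g (vertex (fun k => al k * g k * c ^+ k) be 0 f) =
  vertex al (fun k => c ^+ k * (g k * be k)) 0 (scale g f).
Proof.
apply: (@rmorph_vcoef _ (scale g)) => s; rewrite [X in X * _]scale_coef_shift.
by rewrite [X in _ * X = _]scale_comp scale_hM -scalerAl -scalerAr.
Qed.
End Vertex.

Lemma vcoef_commute (R : comNzRingType) (g hh ah : nat -> R) (c : R)
    (j m N : nat) (F G : {poly R}) :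
  (forall n, \sum_(r < n.+1) g r * hh (n - r)%N = ah n) ->
  (forall i, F`_i = if (i <= m)%N then
     (if i == 0%N then hh m else (1 - c) * hh (m - i)%N) else 0) ->
  (size G <= N)%N ->
  vcoef g j (F * G) = c * (hh m * vcoef g j G) + (1 - c) *
    (\sum_(s < N) G`_s * (if (j <= m + s)%N then ah (m + s - j)%N else 0)
     - \sum_(i < N) hh (m + i.+1)%N * vcoef g (j + i.+1) G).
Proof.
move=> conv FE le_GN; rewrite -(vcoef_conv conv) //.
have -> : F = (c * hh m)%:P + (1 - c)%:P * \sum_(i < m.+1) (hh (m - i)%N)%:P *
  'X^i.
  apply/polyP => i; rewrite FE coefD coefC coefCM coef_sum.
  under eq_bigr do rewrite coefCM coefXn.
  case: (leqP i m) => [le_im|lt_mi].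
    rewrite (bigD1 (inord i)) //= inordK // eqxx mulr1 big1 ?addr0 => [|k nk].
      case: eqP => [->|_]; last by rewrite add0r.
      by rewrite subn0; ring.
    by rewrite -val_eqE /= inordK // eq_sym in nk; rewrite (negPf nk) mulr0.
  rewrite gtn_eqF ?(leq_ltn_trans _ lt_mi) // big1 ?mulr0 ?addr0 // => k _.
  by rewrite gtn_eqF ?mulr0 // (leq_trans (ltn_ord k)).
rewrite mulrDl vcoefD vcoefCM -!mulrA vcoefCM mulr_suml vcoef_sum.
congr (_ + _ * _); apply: eq_bigr => i _.
by rewrite -mulrA vcoefCM.
Qed.

Lemma pleth_h_unitB (A : comNzRingType) (iota : {rmorphism Kqt -> A}) b i :
  pleth iota (fun k => 1 - b ^+ k) (hsym i) = if i == 0%N then 1 else 1 - b.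
Proof.
case: i => [|i]; first by rewrite pleth_h0.
by rewrite pleth_hB !pleth_h_unit mulr1.
Qed.

Lemma coef_shift_h_unitB b m i : (shift (fun k => 1 - b ^+ k) (hsym m))`_i =
  if (i <= m)%N then (if i == 0%N then 1 else 1 - b) *: hsym (m - i) else 0.
Proof.
have := coef_shift_h (fun k => 1 - b ^+ k) (fun=> 1) m i.
rewrite !scale_unit => ->; case: leqP => [_|//].
rewrite (@pleth_ext _ _ _ (fun k => 1 - b ^+ k)) => [|k]; last by rewrite mul1r.
by rewrite pleth_h_unitB.
Qed.

(** * Triangularity *)

(* For j = 0 and (a, b) = (q, t), this is D_0 conjugated by
   p_k |-> (1 - q^k) p_k; the other j occur in the induction on the number of
   parts in mac_op_triangular. *)
Definition mac_op (a b : Kqt) : nat -> Lam -> Lam :=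
  vertex (fun k => 1 - b ^+ k) (fun k => a ^+ k - 1).

Lemma mac_op_hM a b j m N f (G := shift (fun k => 1 - b ^+ k) f) :
  (size G <= N)%N ->
  mac_op a b j (hsym m * f) = b *: (hsym m * mac_op a b j f) + (1 - b) *:
    (\sum_(s < N) G`_s * (if (j <= m + s)%N
                          then a ^+ (m + s - j) *: hsym (m + s - j)%N else 0)
     - \sum_(i < N) hsym (m + i.+1)%N * mac_op a b (j + i.+1) f).
Proof.
move=> le_GN; rewrite -[b *: _]mul_malgC -[(1 - b) *: _]mul_malgC.
rewrite (rmorphB (@malgC {cmonom nat} Kqt)) rmorph1 /mac_op /vertex rmorphM.
apply: (vcoef_commute _ (hh := hsym) (ah :=
  fun n => a ^+ n *: hsym n)) => [n|i|//].
  rewrite -scale_h_pow -(@scale_ext (fun k => (a ^+ k - 1) + 1)) => [|k].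
    by rewrite scale_hD; apply: eq_bigr => r _; rewrite scale_unit.
  by rewrite subrK.
rewrite coef_shift_h_unitB; case: leqP => [_|//]; case: eqP => [->|_].
  by rewrite scale1r subn0.
by rewrite -mul_malgC rmorphB rmorph1.
Qed.

(* nu is obtained from la, up to order, by raising boxes and deleting d. *)
Definition raised (d : nat) (la nu : seq nat) : Prop :=
  (sumn nu + d = sumn la)%N /\
  forall r, exists s, [/\ subseq s nu, (size s <= r)%N
                       & (sumn (take r la) <= sumn s + d)%N].

Lemma raised_refl la : raised 0 la la.
Proof.
split=> [|r]; first by rewrite addn0.
exists (take r la); rewrite take_subseq addn0; split=> //.
by rewrite size_take; case: ltnP.
Qed.

Lemma raised_cons d j m x la nu : raised d la nu -> (x + j = m + d)%N ->
  raised j (m :: la) (x :: nu).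
Proof.
move=> [dsum dtop] xjmd; split=> [|[|r]] /=; first lia.
  by exists [::]; split; rewrite ?sub0seq.
have [s [sub_s size_s le_s]] := dtop r; exists (x :: s).
by rewrite /= eqxx; split=> //; lia.
Qed.

Definition hprod (nu : seq nat) : Lam := \prod_(x <- nu) hsym x.

Lemma hprod_cons x nu : hprod (x :: nu) = hsym x * hprod nu.
Proof. exact: big_cons. Qed.

Definition raised_h d la (f : Lam) :
  Prop := exists2 nu, raised d la nu & f = hprod nu.

Lemma raised_h_mul d j m x la f : (x + j = m + d)%N ->
  lspan (raised_h d la) f -> lspan (raised_h j (m :: la)) (hsym x * f).
Proof.
move=> xjmd; apply: lspan_mull => _ [nu dnu ->].
by exists (x :: nu); [apply: raised_cons dnu xjmd | rewrite hprod_cons].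
Qed.

Lemma shift_hprod_lspan b la s :
  lspan (raised_h s la) (shift (fun k => 1 - b ^+ k) (hprod la))`_s.
Proof.
elim: la s => [|m la IH] s.
  rewrite /hprod big_nil rmorph1 coef1; case: eqP => [->|_]; last exact: lspan0.
  by apply: lspan_gen; exists [::];
    [apply: raised_refl | rewrite /hprod big_nil].
rewrite hprod_cons rmorphM coefM; apply: lspan_sum => i _.
have le_is := leq_ord i.
rewrite [X in X * _]coef_shift_h_unitB; case: leqP => [le_im|_]; last first.
  by rewrite mul0r; apply: lspan0.
rewrite -scalerAl; apply/lspanZ/(raised_h_mul _ (IH _)); lia.
Qed.

Lemma mac_op_lspan a b la j : lspan (raised_h j la) (mac_op a b j (hprod la)).
Proof.
elim: la j => [|m la IH] j.
  rewrite /hprod big_nil; case: j => [|j].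
    rewrite /mac_op vertex1; apply: lspan_gen; exists [::].
      exact: raised_refl.
    by rewrite /hprod big_nil.
  rewrite /mac_op /vertex rmorph1 /vcoef size_poly1 big_ord1 /= mulr0.
  exact: lspan0.
rewrite hprod_cons (@mac_op_hM _ _ _ _ _ _ (leqnn _)).
apply: lspanD; apply: lspanZ.
  exact: raised_h_mul (IH j).
apply: lspanD.
  apply: lspan_sum => s _; case: ifP => [le_j|_]; last by rewrite mulr0;
    apply: lspan0.
  rewrite -scalerAr mulrC; apply/lspanZ/(raised_h_mul _ (shift_hprod_lspan _ _
    _)); lia.
apply/lspanN/lspan_sum => i _.
by apply: (raised_h_mul _ (IH _)); lia.
Qed.

Definition raised_strict (la nu : seq nat) : Prop :=
  raised 0 la nu /\ exists2 x, (0 < x)%N & count_mem x nu != count_mem x la.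

Fixpoint mac_eig (a b : Kqt) (la : seq nat) : Kqt :=
  if la is m :: la' then b * mac_eig a b la' + (1 - b) * a ^+ m else 1.

Lemma raised_strict_cons x d m la nu : all (geq m) la ->
  raised d la nu -> (x = m + d)%N -> (m < x)%N ->
  raised_strict (m :: la) (x :: nu).
Proof.
move=> lem dnu xE mx; split; first by apply: raised_cons dnu _; lia.
exists x; first lia.
rewrite /= eqxx (ltn_eqF mx) /= add0n (_ : count_mem x la = 0%N) //.
apply/count_memPn/negP => /(allP lem) /=; lia.
Qed.

Lemma leading_split (K : comNzRingType) (V : lmodType K) (b c d :
  K) (A C S1 S2 : V) :
  b *: A + (1 - b) *: (d *: C + S1 - S2) - (b * c + (1 - b) * d) *: C =
  b *: (A - c *: C) + (1 - b) *: (S1 - S2).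
Proof.
rewrite -[_ + S1 - S2]addrA; move: (S1 - S2) (1 - b) => S u.
rewrite scalerBr scalerDr scalerDl !scalerA opprD.
move: (b *: A) (_ *: C) (_ *: C) (_ *: S) => x y z w.
by rewrite addrACA; congr (_ + _); rewrite addrAC subrr add0r.
Qed.

(* The operator is commuted past the largest part m: by mac_op_hM every new
   term other than a^m h_m h_la then has a part larger than m. *)
Lemma mac_op_triangular a b la : sorted geq la -> all (leq 1) la ->
  lspan (fun f => exists2 nu, raised_strict la nu & f = hprod nu)
    (mac_op a b 0 (hprod la) - mac_eig a b la *: hprod la).
Proof.
elim: la => [_ _|m la IH] /=.
  by rewrite /hprod big_nil /mac_op vertex1 scale1r subrr; apply: lspan0.
move=> ple /andP[m_gt0 la_gt0].
have lem : all (geq m) la by apply: order_path_min ple => x y z /= ? ?; lia.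
have {}IH := IH (path_sorted ple) la_gt0.
pose G := shift (fun k => 1 - b ^+ k) (hprod la).
rewrite hprod_cons (@mac_op_hM a b 0 m _ _ (leqnSn (size G))) -/G.
rewrite [X in _ *: (X - _)]big_ord_recl.
rewrite [X in _ *: (X + _ - _)](_ : _ = a ^+ m *: (hsym m * hprod la));
  last first.
  by rewrite shift_coef0 leq0n addn0 subn0 -scalerAr mulrC.
rewrite leading_split scalerAr -mulrBr.
apply: lspanD; apply: lspanZ.
  apply: lspan_mull IH => _ [nu [dnu [x x_gt0 xnu]] ->].
  exists (m :: nu); last by rewrite hprod_cons.
  split; first by apply: raised_cons dnu _.
  by exists x => //=; rewrite eqn_add2l.
apply: lspanD.
  apply: lspan_sum => s _; rewrite leq0n lift0 subn0 -scalerAr mulrC;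
    apply: lspanZ.
  apply: lspan_mull (shift_hprod_lspan b la _) => _ [nu dnu ->].
  exists (m + s.+1 :: nu)%N; last by rewrite hprod_cons.
  by apply: raised_strict_cons dnu _ _ => //; lia.
apply/lspanN/lspan_sum => i _; rewrite add0n.
apply: lspan_mull (mac_op_lspan a b la _) => _ [nu dnu ->].
exists (m + i.+1 :: nu)%N; last by rewrite hprod_cons.
by apply: raised_strict_cons dnu _ _ => //; lia.
Qed.

(** * Partitions and dominance *)

Lemma partsP_sorted (la : intpart) : sorted geq la.
Proof. by have /andP[] := partsP la. Qed.

Lemma parts_gt0 (la : intpart) : all (leq 1) la.
Proof.
have /andP[_ la0] := partsP la; apply/allP => x xla; rewrite lt0n.
by apply: contraNneq la0 => <-.
Qed.

Lemma geq_trans : transitive geq.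
Proof. by move=> y x z /= le1 le2; apply: leq_trans le2 le1. Qed.

Lemma geq_total : total geq.
Proof. by move=> x y /=; apply: leq_total. Qed.

Lemma sumn_take_nth (s : seq nat) k :
  sumn (take k.+1 s) = (sumn (take k s) + nth 0 s k)%N.
Proof.
case: (ltnP k (size s)) => [lt_ks|le_sk].
  by rewrite (take_nth 0%N) // sumn_rcons.
by rewrite !take_oversize ?nth_default ?addn0 // leqW.
Qed.

Lemma eq_intpart (la mu : intpart) :
  (forall k, nth 0%N la k = nth 0%N mu k) -> la = mu.
Proof.
move=> eq_nth; apply: val_inj => /=.
have nth_eq0 (nu : intpart) k : (nth 0%N nu k == 0%N) = (size nu <= k)%N.
  case: leqP => [le_k|lt_k]; first by rewrite nth_default.
  by apply/negbTE; rewrite -lt0n; apply: (allP (parts_gt0 nu)); apply: mem_nth.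
apply: (@eq_from_nth _ 0%N) => // ; apply/eqP.
by rewrite eqn_leq -!nth_eq0 eq_nth nth_eq0 leqnn -eq_nth nth_eq0 leqnn.
Qed.

Lemma dominates_refl la : dominates la la.
Proof. by split. Qed.

Lemma dominates_trans mu la nu :
  dominates la mu -> dominates mu nu -> dominates la nu.
Proof.
move=> [s1 d1] [s2 d2]; split=> [|k]; first by rewrite s1.
exact: leq_trans (d2 k) (d1 k).
Qed.

Lemma dominates_anti (la mu : intpart) :
  dominates la mu -> dominates mu la -> la = mu.
Proof.
move=> [_ d1] [_ d2]; have eq_take k : sumn (take k la) = sumn (take k mu).
  by apply/eqP; rewrite eqn_leq d1 d2.
by apply: eq_intpart => k; apply: (@addnI (sumn (take k la)));
  rewrite -sumn_take_nth eq_take [in RHS]eq_take -sumn_take_nth.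
Qed.

Lemma sumn_subseq_le (s t : seq nat) : subseq s t -> (sumn s <= sumn t)%N.
Proof.
elim: t s => [|y t IH] [|x s] //= ; case: eqP => [->|_] /IH /=.
  by rewrite leq_add2l.
by move=> le; apply: leq_trans le (leq_addl _ _).
Qed.

Lemma sumn_subseq_sorted (s t : seq nat) r : sorted geq t -> subseq s t ->
  (size s <= r)%N -> (sumn s <= sumn (take r t))%N.
Proof.
elim: t s r => [|y t IH] [|x s] [|r] //= pt sub le_sr.
have le_xy : (x <= y)%N.
  case: eqP sub => [->//|_ /mem_subseq/(_ x (mem_head x s)) xt].
  exact: (allP (order_path_min geq_trans pt) _ xt).
apply: leq_add => //; apply: IH => //; first exact: path_sorted pt.
by move: sub; case: eqP => // _; apply: subseq_trans (subseq_cons _ _).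
Qed.

Lemma to_part_subproof (nu : seq nat) (s := sort geq (filter (leq 1) nu)) :
  sorted geq s && (0 \notin s)%N.
Proof.
by rewrite sort_sorted ?mem_sort ?mem_filter //; apply: geq_total.
Qed.

Definition to_part (nu : seq nat) : intpart := IntPart (to_part_subproof nu).

Lemma perm_to_part nu : perm_eq (to_part nu) (filter (leq 1) nu).
Proof. by rewrite perm_sort. Qed.

Lemma hprod_to_part nu : hprod (to_part nu) = hprod nu.
Proof.
rewrite /hprod (perm_big _ (perm_to_part nu)) /= big_filter big_mkcond /=.
by apply: eq_bigr => -[|x] //= _; rewrite hsym0.
Qed.

Lemma dominates_to_part la nu : raised 0 la nu -> dominates (to_part nu) la.
Proof.
have sum_pos s : sumn (filter (leq 1) s) = sumn s.
  by elim: s => //= -[|x] s IH /=; rewrite IH.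
move=> [sum_eq top]; split=> [|k].
  by rewrite (perm_sumn (perm_to_part nu)) sum_pos -sum_eq addn0.
have [s [sub_s size_s le_s]] := top k; rewrite addn0 in le_s.
apply: leq_trans le_s _; rewrite -sum_pos.
have /perm_sumn -> : perm_eq (filter (leq 1) s) (sort geq (filter (leq 1) s)).
  by rewrite perm_sym perm_sort.
apply: sumn_subseq_sorted; first exact: partsP_sorted (to_part nu).
  apply: subseq_sort; [exact: geq_total|exact: geq_trans|].
  rewrite subseq_filter filter_all.
  by apply: subseq_trans sub_s; apply: filter_subseq.
rewrite size_sort; apply: leq_trans size_s.
exact: size_subseq (filter_subseq _ _).
Qed.

Lemma count_to_part x nu : (0 < x)%N ->
  count_mem x (to_part nu) = count_mem x nu.
Proof.
move=> x_gt0; rewrite (seq.permP (perm_to_part nu)) count_filter.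
by apply: eq_count => y /=; case: eqP => // ->.
Qed.

Lemma to_part_neq (la : intpart) nu : raised_strict la nu -> to_part nu <> la.
Proof.
by move=> [_ [x x_gt0 /eqP neq]] eq_la; apply: neq;
  rewrite -count_to_part ?eq_la.
Qed.

Lemma mac_eigE a b la : mac_eig a b la = 1 - (1 - a) * (1 - b) * B la a b.
Proof.
elim: la => [|m la IH] /=; first by rewrite /B big_ord0 mulr0 subr0.
have -> : B (m :: la) a b = (\sum_(j < m) a ^+ j) + b * B la a b.
  rewrite /B big_ord_recl /=; congr (_ + _).
    by apply: eq_bigr => j _; rewrite expr0 mul1r.
  rewrite mulr_sumr; apply: eq_bigr => i _; rewrite mulr_sumr.
  by apply: eq_bigr => j _; rewrite exprS mulrA.
have aE : a ^+ m = 1 - (1 - a) * \sum_(j < m) a ^+ j.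
  by rewrite -[1 - a]opprB mulNr -subrX1 opprK addrC subrK.
by rewrite IH aE; ring.
Qed.

Lemma ltn_count_nth (mu : seq nat) i j : sorted geq mu ->
  (i < count (fun m => j < m)%N mu)%N = (j < nth 0%N mu i)%N.
Proof.
elim: mu i => [|m mu IH] i /= pm; first by rewrite nth_nil !ltn0.
have {}IH := IH _ (path_sorted pm).
case: (ltnP j m) => [lt_jm|le_mj].
  by case: i => [|i] //=; rewrite add1n ltnS IH.
have le_m x : x \in mu -> (x <= j)%N.
  by move=> /(allP (order_path_min geq_trans pm)) /= le_xm;
    apply: leq_trans le_mj.
rewrite add0n (_ : count _ mu = 0%N).
  case: i => [|i] /=; first by rewrite (leq_gtF le_mj).
  case: (ltnP i (size mu)) => [lt_i|le_i]; last by rewrite nth_default.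
  by apply/esym/negbTE; rewrite -leqNgt le_m ?mem_nth.
apply/eqP; rewrite -leqn0 leqNgt -has_count; apply/hasPn => x xmu.
by rewrite -leqNgt le_m.
Qed.

Lemma nth_conj (mu : seq nat) j : sorted geq mu ->
  nth 0%N (conj_parts mu) j = count (fun m => j < m)%N mu.
Proof.
move=> smu; rewrite /conj_parts; case: (ltnP j (head 0%N mu)) => [lt_j|le_j].
  by rewrite (nth_map 0%N) ?size_iota // nth_iota.
rewrite nth_default ?size_map ?size_iota //; apply/esym/eqP.
by rewrite -leqn0 leqNgt ltn_count_nth // nth0 -leqNgt.
Qed.

Lemma conj_subproof (mu : intpart) :
  sorted geq (conj_parts mu) && (0 \notin conj_parts mu)%N.
Proof.
apply/andP; split.
  apply: (homo_sorted (e := ltn)); last exact: iota_ltn_sorted.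
  move=> i j /= lt_ij; apply: sub_count => m /=; exact: ltn_trans.
apply/mapP => -[j]; rewrite mem_iota add0n /= => lt_j /eqP.
by rewrite eq_sym -leqn0 leqNgt ltn_count_nth ?partsP_sorted // nth0 lt_j.
Qed.

Definition conj (mu : intpart) : intpart := IntPart (conj_subproof mu).

Lemma conjK : involutive conj.
Proof.
move=> mu; apply: eq_intpart => i.
have eqnP a b : (forall j, (j < a)%N = (j < b)%N) -> a = b.
  by move=> ab; case: (ltngtP a b) => // lt; [have := ab a|have := ab b];
    rewrite lt ltnn.
apply: eqnP => j; have smu := partsP_sorted mu;
  have scmu := partsP_sorted (conj mu).
rewrite nth_conj //.
by rewrite ltn_count_nth // nth_conj // ltn_count_nth.
Qed.

Lemma sumn_take_conj (mu : intpart) k :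
  sumn (take k (conj mu)) = (\sum_(m <- mu) minn m k)%N.
Proof.
elim: k => [|k IH].
  by rewrite take0 big1 // => m _; rewrite minn0.
rewrite sumn_take_nth IH nth_conj ?partsP_sorted // -sum1_count [X in (_ +
  X)%N]big_mkcond /=.
rewrite -big_split; apply: eq_bigr => m _ /=.
by case: ltnP; lia.
Qed.

Lemma sumn_conj (mu : intpart) : sumn (conj mu) = sumn mu.
Proof.
rewrite -[conj mu : seq nat]take_size sumn_take_conj sumnE.
rewrite size_map size_iota !big_seq; apply: eq_bigr => m m_mu.
apply/minn_idPl; have smu := partsP_sorted mu.
case: (parts mu) smu m_mu => // x s /= ps; rewrite inE => /predU1P[->//|ms].
exact: (allP (order_path_min geq_trans ps) _ ms).
Qed.

(* With sumn_take_count: the sum of the (m - k)^+ is the maximum over r of the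
   sum of the first r parts minus r k. *)
Lemma sumn_take_le (s : seq nat) r k :
  (sumn (take r s) <= \sum_(m <- s) (m - k) + r * k)%N.
Proof.
elim: s r => [|m s IH] [|r] //=; rewrite big_cons mulSn.
have := IH r; lia.
Qed.

Lemma sumn_take_count (s : seq nat) k : sorted geq s ->
  let r := count (fun m => k < m)%N s in
  sumn (take r s) = (\sum_(m <- s) (m - k) + r * k)%N.
Proof.
elim: s => [|m s IH] /= pm; first by rewrite big_nil.
rewrite big_cons; case: (ltnP k m) => [lt_km|le_mk] /=.
  by rewrite IH ?(path_sorted pm) // mulSn; lia.
have le_s x : x \in s -> (x <= k)%N.
  by move=> /(allP (order_path_min geq_trans pm)) /= le_xm;
    apply: leq_trans le_mk.
rewrite add0n (_ : count _ s = 0%N); last first.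
  apply/eqP; rewrite -leqn0 leqNgt -has_count; apply/hasPn => x xs.
  by rewrite -leqNgt le_s.
rewrite big_seq big1 /= => [|x xs]; last by apply/eqP; rewrite subn_eq0 le_s.
by apply/esym/eqP; rewrite addn0 addn_eq0 subn_eq0 le_mk mul0n.
Qed.

Lemma dominates_conj (la mu : intpart) :
  dominates la mu -> dominates (conj mu) (conj la).
Proof.
move=> [sum_eq dom]; split=> [|k]; first by rewrite !sumn_conj.
rewrite !sumn_take_conj.
have splitE (s : seq nat) :
  (\sum_(m <- s) minn m k + \sum_(m <- s) (m - k))%N = sumn s.
  by rewrite -big_split sumnE; apply: eq_bigr => m _ /=; lia.
have := splitE la; have := splitE mu; rewrite sum_eq.
have := dom (count (fun m => k < m)%N mu).
rewrite sumn_take_count ?partsP_sorted //.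
have := sumn_take_le la (count (fun m => k < m)%N mu) k.
lia.
Qed.

Lemma sumn_mkseq (F : nat -> nat) k : sumn (mkseq F k) = (\sum_(i < k) F i)%N.
Proof.
by elim: k => [|k IH]; rewrite ?big_ord0 // mkseqS sumn_rcons IH big_ord_recr.
Qed.

Lemma sum_minn_sum (f : nat -> nat) n : injective f ->
  (\sum_(i < n) i <= \sum_(i < n) f i)%N.
Proof.
have path_le (s : seq nat) a :
  all (leq a) s -> sorted ltn s -> (sumn (iota a (size s)) <= sumn s)%N.
  elim: s a => //= x s IH a /andP[le_ax _] px; apply: leq_add => //.
  apply: IH (path_sorted px);
    apply: sub_all (order_path_min ltn_trans px) => y /=.
  exact: leq_ltn_trans.
move=> f_inj; pose s := sort leq (mkseq f n).
have -> : (\sum_(i < n) f i = sumn s)%N.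
  by rewrite (perm_sumn (permEl (perm_sort _ _))) sumn_mkseq.
have -> : (\sum_(i < n) i = sumn (iota 0 (size s)))%N.
  by rewrite size_sort size_mkseq -[iota 0 n]map_id -/(mkseq id n) sumn_mkseq.
apply: path_le; first by apply/allP.
by rewrite ltn_sorted_uniq_leq sort_uniq mkseq_uniq // sort_sorted //;
  apply: leq_total.
Qed.

Lemma schur_raised (la : seq nat) : lspan (raised_h 0 la) (schur la).
Proof.
rewrite /schur /determinant; apply: lspan_sum => /= s _;
  change {perm 'I_(size la)} in s.
set P := \prod_i _.
suff : lspan (raised_h 0 la) P.
  by case: (odd_perm s) => PP; rewrite ?mul1r // mulN1r; apply: lspanN.
pose n := size la; pose f i := if insub i is Some o then s o : nat else i.
have fE (i : 'I_n) : f i = s i by rewrite /f valK.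
have f_inj : injective f.
  move=> i j; rewrite /f; case: insubP => [u _ <-|ni];
    case: insubP => [v _ <-|nj] //.
  - by move=> /val_inj/perm_inj ->.
  - by move=> E; move: nj; rewrite -E ltn_ord.
  by move=> E; move: ni; rewrite E ltn_ord.
case: (boolP [forall i : 'I_n,
  (i <= nth 0 la i + f i)%N]) => [/forallP le_i|]; last first.
  rewrite negb_forall => /existsP[i ni].
  rewrite /P (bigD1 i) //= mxE -fE (negPf ni) mul0r; exact: lspan0.
pose g i := (nth 0 la i + f i - i)%N.
apply: lspan_gen; exists (mkseq g n); last first.
  rewrite /hprod big_map -[n in iota 0 n]subn0 -/(index_iota 0 n) big_mkord.
  by apply: eq_bigr => i _; rewrite mxE -fE le_i hsymE.
have sum_take k : (k <= n)%N -> sumn (take k la) = (\sum_(i < k) nth 0 la i)%N.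
  elim: k => [|k IH] le_k; first by rewrite take0 big_ord0.
  by rewrite sumn_take_nth IH ?big_ord_recr // ltnW.
have sum_g k : (k <= n)%N -> (\sum_(i < k) g i + \sum_(i < k) i)%N =
    (\sum_(i < k) nth 0 la i + \sum_(i < k) f i)%N.
  move=> le_kn; rewrite -!big_split; apply: eq_bigr => i _ /=.
  by rewrite /g subnK // (le_i (widen_ord le_kn i)).
split.
  rewrite addn0 sumn_mkseq -[la in RHS]take_size sum_take //.
  have := sum_g n (leqnn n).
  have -> : (\sum_(i < n) f i = \sum_(i < n) i)%N.
    by rewrite [RHS](reindex_inj (@perm_inj _ s)); apply: eq_bigr => i _.
  exact: addIn.
move=> r; exists (take r (mkseq g n)); rewrite take_subseq addn0; split=> //.
  by rewrite size_take; case: ltnP.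
case: (leqP r n) => [le_rn|lt_nr].
  have -> : take r (mkseq g n) =
    mkseq g r by rewrite /mkseq -map_take take_iota (minn_idPl le_rn).
  rewrite sumn_mkseq sum_take //.
  have := sum_g r le_rn; have := sum_minn_sum r f_inj; lia.
rewrite !take_oversize ?size_mkseq // ?(ltnW lt_nr) //.
rewrite sumn_mkseq.
have -> : sumn la = (\sum_(i < n) nth 0 la i)%N by rewrite -sum_take //
  take_size.
have := sum_g n (leqnn n); have := sum_minn_sum n f_inj; lia.
Qed.

(** * Eigenvectors *)

Definition ispan (K : fieldType) (V : lmodType K) (I : Type) (P : I -> Prop)
    (G : I -> V) : V -> Prop :=
  lspan (fun f => exists2 la, P la & f = G la).

Definition ifree (K : fieldType) (V : lmodType K) (I : eqType) (G : I -> V) :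
  Prop :=
  forall (s : seq I) (c : I -> K), uniq s ->
    \sum_(la <- s) c la *: G la = 0 -> forall la, la \in s -> c la = 0.

Section IndexedSpan.
Context (K : fieldType) (V : lmodType K) (I : eqType).
Implicit Types (P Q : I -> Prop) (G : I -> V).

Lemma ispan_gen P G la : P la -> ispan P G (G la).
Proof. by move=> Pla; apply: lspan_gen; exists la. Qed.

Lemma ispan_trans P Q G G' f : (forall la, P la -> ispan Q G' (G la)) ->
  ispan P G f -> ispan Q G' f.
Proof. by move=> PQ; apply: lspan_trans => _ [la Pla ->]; apply: PQ. Qed.

Lemma ispan_sub P Q G f : (forall la,
  P la -> Q la) -> ispan P G f -> ispan Q G f.
Proof. by move=> PQ; apply: ispan_trans => la /PQ; apply: ispan_gen. Qed.

Lemma ispan_expand P G f : ispan P G f ->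
  exists (s : seq I) (c : I -> K),
  [/\ uniq s, forall la, la \in s -> P la & f = \sum_(la <- s) c la *: G la].
Proof.
elim=> [|c v {}f [la Pla ->] _ [s [d [us Ps ->]]]].
  by exists [::], (fun=> 0); split; rewrite ?big_nil.
case: (boolP (la \in s)) => [las|nlas].
  exists s, (fun nu => d nu + (if nu == la then c else 0)); split=> //.
  under [RHS]eq_bigr do rewrite scalerDl.
  rewrite big_split /= addrC; congr (_ + _).
  rewrite (bigD1_seq la) //= eqxx big1 ?addr0 // => nu /negPf ->.
  exact: scale0r.
exists (la :: s), (fun nu => if nu == la then c else d nu); split=> [|nu|].
- by rewrite /= nlas.
- by rewrite inE => /predU1P[->|/Ps].
rewrite big_cons eqxx; congr (_ + _); apply: eq_big_seq => nu nus;
  case: eqP => // nuE.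
by rewrite -nuE nus in nlas.
Qed.

Lemma ifree_ispanI P Q G f : ifree G -> ispan P G f -> ispan Q G f ->
  ispan (fun la => P la /\ Q la) G f.
Proof.
move=> freeG /ispan_expand[s1 [c1 [u1 P1 f1]]] /ispan_expand[s2 [c2 [u2 Q2
  f2]]].
pose s := undup (s1 ++ s2).
pose ext (r : seq I) (c : I -> K) la := if la \in r then c la else 0.
have sum_ext r c : uniq r -> {subset r <= s} ->
    \sum_(la <- s) ext r c la *: G la = \sum_(la <- r) c la *: G la.
  move=> ur rs; rewrite (bigID (mem r)) /= [X in _ + X]big1 ?addr0; last first.
    by move=> la /negPf nr; rewrite /ext nr scale0r.
  rewrite -big_filter (perm_big r).
    by apply: eq_big_seq => la lar; rewrite /ext lar.
  apply: uniq_perm => // [|la]; first by rewrite filter_uniq ?undup_uniq.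
  by rewrite mem_filter; apply: andb_idr => /rs.
have sub1 : {subset s1 <= s} by move=> la; rewrite mem_undup mem_cat => ->.
have sub2 : {subset s2 <= s} by move=> la; rewrite mem_undup mem_cat orbC => ->.
have diff0 : \sum_(la <- s) (ext s1 c1 la - ext s2 c2 la) *: G la = 0.
  under eq_bigr do rewrite scalerBl.
  by rewrite sumrB !sum_ext // -f1 -f2 subrr.
have eq_ext := freeG _ _ (undup_uniq _) diff0.
rewrite f1 big_seq; apply: lspan_sum => la la1.
case: (boolP (la \in s2)) => [la2|nla2].
  by apply/lspanZ/ispan_gen; split; [apply: P1|apply: Q2].
have := eq_ext la (sub1 _ la1); rewrite /ext la1 (negPf nla2) subr0 => ->.
by rewrite scale0r; apply: lspan0.
Qed.

Lemma ifree_neq0 G la : ifree G -> G la <> 0.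
Proof.
move=> freeG G0; have := freeG [:: la] (fun=> 1) isT.
rewrite big_seq1 scale1r => /(_ G0 la); rewrite mem_head => /(_ isT) /eqP.
by rewrite oner_eq0.
Qed.

Lemma ifree_ispan_mem P G la : ifree G -> ispan P G (G la) -> P la.
Proof.
move=> freeG PG; have := ifree_ispanI freeG PG (@ispan_gen (eq la) _ _ erefl).
move=> /ispan_expand[[|nu s] [c [_ Ps]]].
  by rewrite big_nil => /(ifree_neq0 freeG).
by have [Pnu ->] := Ps nu (mem_head _ _).
Qed.

Lemma ispan_split P G f la :
  ispan P G f -> exists a, ispan (fun nu => P nu /\ nu <> la) G (f - a *: G la).
Proof.
elim=> [|c v {}f [nu Pnu ->] _ [a IH]].
  by exists 0; rewrite scale0r subrr; apply: lspan0.
have [->|neq] := eqVneq nu la.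
  by exists (c + a); rewrite scalerDl opprD addrACA subrr add0r.
exists a; rewrite -addrA; apply: lspanD => //.
by apply/lspanZ/ispan_gen; split=> //; apply/eqP.
Qed.

Lemma ifree_inv G (j : I -> I) : involutive j -> ifree G -> ifree (G \o j).
Proof.
move=> jK freeG s c us sum0 la las; rewrite -[la]jK.
apply: (freeG (map j s) (c \o j)); last by rewrite map_f.
  by rewrite map_inj_uniq //; apply: inv_inj jK.
by rewrite big_map -[RHS]sum0; apply: eq_bigr => nu _ /=; rewrite jK.
Qed.
End IndexedSpan.

Lemma ispan_scale (I : Type) (P : I -> Prop) (G : I -> Lam) g f :
  ispan P G f -> ispan P (scale g \o G) (scale g f).
Proof.
apply: lspan_map => [|c f1 f2|_ [la Pla ->]]; first exact: rmorph0.
  by rewrite rmorphD /= scaleZ.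
by apply: lspan_gen; exists la.
Qed.

Lemma ifree_scale (I : eqType) (G : I -> Lam) g g' :
  (forall f, scale g' (scale g f) = f) -> ifree G -> ifree (scale g \o G).
Proof.
move=> gK freeG s c us sum0; apply: (freeG s c us).
have : scale g (\sum_(la <- s) c la *: G la) = 0.
  by rewrite rmorph_sum -[RHS]sum0; apply: eq_bigr => la _; apply: scaleZ.
by move/(congr1 (scale g')); rewrite gK rmorph0.
Qed.

Lemma in_span_ispan P (G : intpart -> Lam) f : in_span P G f -> ispan P G f.
Proof.
case=> s [c [Ps ->]]; rewrite big_seq; apply: lspan_sum => la /Ps Pla.
by apply/lspanZ/lspan_gen; exists la.
Qed.

Lemma hprod_to_part_ispan (P : intpart -> Prop) nu :
  P (to_part nu) -> ispan P hprod (hprod nu).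
Proof.
by move=> Pnu; rewrite -hprod_to_part; apply: lspan_gen; exists (to_part nu).
Qed.

Lemma mac_op_ispan a b (la : intpart) :
  ispan (fun nu : intpart => dominates nu la) hprod (mac_op a b 0 (hprod la)).
Proof.
apply: lspan_trans (mac_op_lspan a b la 0) => _ [nu dnu ->].
exact/hprod_to_part_ispan/dominates_to_part.
Qed.

Lemma mac_op_ispan_strict a b (la : intpart) :
  ispan (fun nu : intpart => dominates nu la /\ nu <> la) hprod
    (mac_op a b 0 (hprod la) - mac_eig a b la *: hprod la).
Proof.
apply: lspan_trans (mac_op_triangular a b (partsP_sorted la) (parts_gt0 la)).
move=> _ [nu dnu ->]; apply: hprod_to_part_ispan.
by split; [apply: dominates_to_part; case: dnu | apply: to_part_neq].
Qed.

Lemma schur_ispan (la : intpart) :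
  ispan (fun nu : intpart => dominates nu la) hprod (schur la).
Proof.
apply: lspan_trans (schur_raised la) => _ [nu dnu ->].
exact/hprod_to_part_ispan/dominates_to_part.
Qed.

(* Dominance increases the sum of the partial sums, so its strict part is
   well founded upwards. *)
Lemma dominance_ind (P : intpart -> Prop) :
  (forall la : intpart,
     (forall nu : intpart, dominates nu la -> nu <> la -> P nu) -> P la) ->
  forall la, P la.
Proof.
move=> step la; pose n := sumn la.
pose w (mu : intpart) := (\sum_(k < n.+1) sumn (take k mu))%N.
have w_le (mu : intpart) : sumn mu = n -> (w mu <= n.+1 * n)%N.
  move=> mun; have -> : (n.+1 * n = \sum_(k < n.+1) n)%N.
    by rewrite sum_nat_const card_ord.
  by apply: leq_sum => k _; rewrite -[X in (_ <= X)%N]mun sumn_subseq_le //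
    take_subseq.
suff ind d : forall mu : intpart,
  sumn mu = n -> (n.+1 * n - w mu < d)%N -> P mu.
  exact: (ind (n.+1 * n - w la).+1).
elim: d => // d IH mu mun le_d; apply: step => nu [sum_nu dnu] neq.
have nun : sumn nu = n by rewrite sum_nu.
apply: IH => //.
suff : (w mu < w nu)%N by have := w_le nu nun; lia.
rewrite ltn_neqAle leq_sum ?andbT => [|k _]; last exact: dnu.
apply/eqP => w_eq; apply: neq; apply: dominates_anti; split=> // k.
have [le_k|lt_k] := leqP k n.
  have wE (ka : intpart) : w ka = (sumn (take k ka) +
      \sum_(i < n.+1 | i != inord k) sumn (take i ka))%N.
    by rewrite /w (bigD1 (inord k)) //= inordK.
  have : (\sum_(i < n.+1 | i != inord k) sumn (take i mu) <=
          \sum_(i < n.+1 | i != inord k) sumn (take i nu))%N.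
    by apply: leq_sum => i _; apply: dnu.
  have := dnu k; have := wE mu; have := wE nu; lia.
have size_le (ka : intpart) : sumn ka = n -> (size ka <= k)%N.
  move=> kan; apply: leq_trans (_ : (sumn ka <= _)%N); last by rewrite kan ltnW.
  elim: (parts ka) (parts_gt0 ka) => //= x s IHs /andP[x_gt0 /IHs]; lia.
by rewrite !take_oversize ?size_le // mun nun.
Qed.

Definition above (mu : intpart) : intpart -> Prop := fun la => dominates la mu.

Lemma hprod_ispan (G : intpart -> Lam) : ifree G ->
  (forall mu, ispan (above mu) hprod (G mu)) ->
  forall la, ispan (above la) G (hprod la).
Proof.
move=> freeG triG; elim/dominance_ind => la IH.
have [a] := ispan_split la (triG la); set f := _ - _ => fP.
have {}fP : ispan (fun nu : intpart => dominates nu la /\ nu <> la) G f.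
  apply: ispan_trans fP => nu [dnu neq];
    apply: ispan_sub (IH nu dnu neq) => ka dka.
  split; first exact: dominates_trans dka dnu.
  by move=> kala; apply: neq; apply: dominates_anti => //; rewrite -kala.
have Gla : G la = f + a *: hprod la by rewrite subrK.
have [a0|a_neq0] := eqVneq a 0.
  have : ispan (fun nu : intpart => dominates nu la /\ nu <> la) G (G la).
    by rewrite Gla a0 scale0r addr0.
  by move/(ifree_ispan_mem freeG) => [_].
have -> : hprod la = a^-1 *: (G la - f).
  by rewrite Gla addrC addKr scalerA mulVf // scale1r.
apply/lspanZ/lspanD; first by apply: ispan_gen; apply: dominates_refl.
by apply: lspanN; apply: ispan_sub fP => nu [].
Qed.

Lemma mac_opD a b f g : mac_op a b 0 (f + g) = mac_op a b 0 f + mac_op a b 0 g.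
Proof. exact: vertexD. Qed.

Lemma mac_opZ a b c f : mac_op a b 0 (c *: f) = c *: mac_op a b 0 f.
Proof. exact: vertexZ. Qed.

Lemma ispan_lin (K : fieldType) (V W : lmodType K) (I J : Type) (P :
  I -> Prop) (Q : J -> Prop)
    (G : I -> V) (G' : J -> W) (F : V -> W) :
  F 0 = 0 -> (forall c f g, F (c *: f + g) = c *: F f + F g) ->
  (forall la, P la -> ispan Q G' (F (G la))) ->
  forall f, ispan P G f -> ispan Q G' (F f).
Proof.
move=> F0 Flin FP; apply: lspan_map => // _ [la Pla ->]; exact: FP.
Qed.

Lemma lspan_eq_lin (K : fieldType) (V W : lmodType K) (X : V -> Prop) (L L' :
  V -> W) :
  L 0 = 0 -> L' 0 = 0 -> (forall c f g, L (c *: f + g) = c *: L f + L g) ->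
  (forall c f g, L' (c *: f + g) = c *: L' f + L' g) ->
  (forall v, X v -> L v = L' v) -> forall f, lspan X f -> L f = L' f.
Proof.
move=> L0 L'0 Llin L'lin LL' f; elim=> [|c v {}f Xv _ IH];
  first by rewrite L0 L'0.
by rewrite Llin L'lin LL' // IH.
Qed.

Lemma mac_op_up a b (mu : intpart) f :
  ispan (above mu) hprod f -> ispan (above mu) hprod (mac_op a b 0 f).
Proof.
apply: ispan_lin => [|c f1 f2|la dla]; first exact: vertex0.
  by rewrite mac_opD mac_opZ.
by apply: ispan_sub (mac_op_ispan a b la) => nu dnu;
  apply: dominates_trans dnu dla.
Qed.

Lemma mac_op_up_strict a b (mu : intpart) f : ispan (above mu) hprod f ->
  ispan (fun la : intpart => dominates la mu /\ la <> mu) hprod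
    (mac_op a b 0 f - mac_eig a b mu *: f).
Proof.
move=> /(ispan_split mu)[c fP]; set f' := f - _ in fP.
have -> : f = c *: hprod mu + f' by rewrite addrC subrK.
rewrite mac_opD mac_opZ scalerDr opprD addrACA scalerA mulrC -scalerA -scalerBr.
apply: lspanD; first exact/lspanZ/mac_op_ispan_strict.
apply: lspanD; last exact/lspanN/lspanZ.
apply: ispan_lin fP => [|d f1 f2|la [dla neq]]; first exact: vertex0.
  by rewrite mac_opD mac_opZ.
apply: ispan_sub (mac_op_ispan a b la) => nu dnu; split.
  exact: dominates_trans dnu dla.
by move=> numu; apply: neq; apply: dominates_anti => //; rewrite -numu.
Qed.

Lemma ispan_unscale g g' (I : eqType) (P : I -> Prop) (G : I -> Lam) f :
  (forall f, scale g' (scale g f) = f) ->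
  ispan P (scale g \o G) (scale g f) -> ispan P G f.
Proof.
move=> gK /(ispan_scale g'); rewrite gK; apply: ispan_trans => la Pla /=.
by rewrite gK; apply: ispan_gen.
Qed.

Section Eigen.
Variables (H : intpart -> Lam) (V : Lam -> Lam) (a b : Kqt).
Variables (g1 g1' g2 g2' : nat -> Kqt).
Hypothesis freeH : ifree H.
Hypothesis g1K : forall f, scale g1' (scale g1 f) = f.
Hypothesis g2K : forall f, scale g2' (scale g2 f) = f.
Hypothesis tri1 : forall mu, ispan (above mu) hprod (scale g1 (H mu)).
Hypothesis tri2 : forall mu, ispan (above (conj mu)) hprod (scale g2 (H mu)).
Hypothesis V1 : forall f, scale g1 (V f) = mac_op a b 0 (scale g1 f).
Hypothesis V2 : forall f, scale g2 (V f) = mac_op b a 0 (scale g2 f).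

Lemma hprod_ispan_scale la : ispan (above la) (scale g1 \o H) (hprod la).
Proof. by apply: hprod_ispan tri1 _; apply: ifree_scale g1K freeH. Qed.

Lemma hprod_ispan_scale_conj la :
  ispan (above la) (scale g2 \o (H \o conj)) (hprod la).
Proof.
apply: hprod_ispan => [|mu]; last by have := tri2 (conj mu); rewrite conjK.
by apply: ifree_scale g2K _; apply: ifree_inv conjK freeH.
Qed.

(* Both triangularities are preserved by V and meet in the line of H mu. *)
Lemma modified_macdonald_eigen mu : V (H mu) = mac_eig a b mu *: H mu.
Proof.
have up1 : ispan (above mu) H (V (H mu)).
  apply: (ispan_unscale g1K); rewrite V1.
  apply: ispan_trans (mac_op_up a b (tri1 mu)) => la dla.
  apply: ispan_sub (hprod_ispan_scale la) => nu dnu.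
  exact: dominates_trans dnu dla.
have up2 : ispan (above (conj mu) \o conj) H (V (H mu)).
  have : ispan (above (conj mu)) (H \o conj) (V (H mu)).
    apply: (ispan_unscale g2K); rewrite V2.
    apply: ispan_trans (mac_op_up b a (tri2 mu)) => la dla.
    apply: ispan_sub (hprod_ispan_scale_conj la) => nu dnu.
    exact: dominates_trans dnu dla.
  by apply: ispan_trans => la dla; apply: ispan_gen; rewrite /= conjK.
have line : ispan (eq mu) H (V (H mu)).
  apply: ispan_sub (ifree_ispanI freeH up1 up2) => la [d1 d2].
  rewrite -[mu]conjK -[la]conjK; congr conj.
  by apply: dominates_anti => //; apply: dominates_conj.
have [k Vk] : exists k, V (H mu) = k *: H mu.
  elim: line => [|c v f [_ <- ->] _ [k ->]]; first by exists 0; rewrite scale0r.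
  by exists (c + k); rewrite scalerDl.
have [k_eq|neq] := eqVneq k (mac_eig a b mu); first by rewrite -k_eq; exact: Vk.
have := mac_op_up_strict a b (tri1 mu).
rewrite -V1 Vk scaleZ -scalerBl => /(lspanZ (k - mac_eig a b mu)^-1).
rewrite scalerA mulVf ?subr_eq0; last exact: neq.
rewrite scale1r => strict.
have : ispan (fun la : intpart => dominates la mu /\ la <> mu) (scale g1 \o H)
    ((scale g1 \o H) mu).
  apply: ispan_trans strict => la [dla nla].
  apply: ispan_sub (hprod_ispan_scale la) => nu dnu; split.
    exact: dominates_trans dnu dla.
  by move=> numu; apply: nla; apply: dominates_anti => //; rewrite -numu.
case/(@ifree_ispan_mem _ _ _ _ (scale g1 \o H) mu (ifree_scale g1K freeH)) => _.
by case.
Qed.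
End Eigen.

Lemma scaleK g (gV := fun k => (g k)^-1) : (forall k, g k.+1 != 0) ->
  forall f, scale gV (scale g f) = f.
Proof.
move=> g_neq0 f; rewrite scale_comp -[RHS]scale_unit; apply: scale_ext => k.
by rewrite /gV mulVf.
Qed.

(* The value of h_(n+1)[(1 - a)(1 - b)], with the denominator cleared. *)
Lemma pleth_h_M (a b : Kqt) n : (1 - a * b) *
    pleth (A := Kqt) idfun (fun k => (1 - a ^+ k) * (1 - b ^+ k)) (hsym n.+1) =
  (1 - a) * (1 - b) * (1 - (a * b) ^+ n.+1).
Proof.
pose E1 k : Kqt := 1 + (a * b) ^+ k.
pose E2 k : Kqt := E1 k - a ^+ k.
pose S m := pleth (A := Kqt) idfun E1 (hsym m).
have SS m : S m.+1 = 1 + a * b * S m.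
  have := pleth_hB (idfun : {rmorphism Kqt -> Kqt}) (a * b) E1 m.
  rewrite (@pleth_ext _ _ _ (fun=> 1)) => [|k]; last by rewrite addrK.
  by rewrite pleth_h_unit => /eqP; rewrite eq_sym subr_eq => /eqP.
have SE m : (1 - a * b) * S m = 1 - (a * b) ^+ m.+1.
  elim: m => [|m IH]; first by rewrite /S pleth_h0 mulr1.
  rewrite SS mulrDr mulr1 mulrCA IH [in RHS]exprS; ring.
rewrite (@pleth_ext _ _ _ (fun k => E2 k - b ^+ k)) => [|k]; last first.
  by rewrite /E2 /E1 exprMn; ring.
rewrite pleth_hB pleth_hB -/(S n.+1) -/(S n).
case: n => [|n].
  rewrite pleth_h0 SS /S pleth_h0; ring.
rewrite pleth_hB -/(S n.+1) -/(S n) !mulrBr !(mulrCA (1 - a * b)) !SE !exprS.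
ring.
Qed.

(* D_0 for eps = 1 and (a, b) = (q, t); D_0^* for eps = -1 and
   (a, b) = (1/q, 1/t). *)
Definition vop (eps a b : Kqt) : Lam -> Lam :=
  vertex (fun k => eps * ((1 - a ^+ k) * (1 - b ^+ k))) (fun=> - eps) 0.

Lemma vopZ eps a b c f : vop eps a b (c *: f) = c *: vop eps a b f.
Proof. exact: vertexZ. Qed.

Lemma vop_sym eps a b f : vop eps a b f = vop eps b a f.
Proof. by apply: vertex_ext => // k; rewrite [_ * (1 - b ^+ _)]mulrC. Qed.

(* The powers of c come from substituting z / c for z, which does not affect
   the coefficient of z^0. *)
Lemma scale_vop eps c a b g f : eps * eps = 1 ->
  (forall k, g k.+1 * c ^+ k.+1 = eps * (1 - a ^+ k.+1)) ->
  scale g (vop eps a b f) = mac_op a b 0 (scale g f).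
Proof.
move=> eps2 gc.
have -> : vop eps a b f =
    vertex (fun k => (1 - b ^+ k) * g k * c ^+ k) (fun=> - eps) 0 f.
  by apply: vertex_ext => // k; rewrite -mulrA gc; ring.
rewrite scale_vertex; apply: vertex_ext => // k.
rewrite mulrA [c ^+ _ * _]mulrC gc mulrN mulrC mulrA eps2; ring.
Qed.

Lemma sum_geometric_diff (K : fieldType) (V : lmodType K) (X : nat -> K) (u :
  nat -> V)
    (x r : K) N :
  X 0%N = 1 -> (forall i, X i.+1 = r * (1 - x ^+ i.+1)) ->
  \sum_(s < N.+1) X s *: u s =
  u 0%N + r *: (\sum_(s < N.+1) u s - \sum_(s < N.+1) x ^+ s *: u s).
Proof.
move=> X0 XS; rewrite big_ord_recl X0 scale1r; congr (_ + _).
rewrite big_ord_recl [in RHS]big_ord_recl expr0 scale1r opprD addrACA subrr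
  add0r.
rewrite -sumrB scaler_sumr; apply: eq_bigr => s _.
by rewrite XS -scalerA scalerBl scale1r.
Qed.

Lemma vop_scale_h eps a b n : eps * eps = 1 -> 1 - a * b != 0 ->
  vop eps a b (scale (fun=> eps) (hsym n.+1)) = scale (fun=> eps) (hsym n.+1) -
   ((1 - a) * (1 - b) / (1 - a * b)) *:
      scale (fun k => eps * (1 - (a * b) ^+ k)) (hsym n.+1).
Proof.
move=> eps2 ab1; pose al k := eps * ((1 - a ^+ k) * (1 - b ^+ k));
  pose N := n.+1.
pose X i := pleth (A := Kqt) idfun (fun k =>
  (1 - a ^+ k) * (1 - b ^+ k)) (hsym i).
pose r := (1 - a) * (1 - b) / (1 - a * b).
have X0 : X 0%N = 1 by apply: pleth_h0.
have XS i : X i.+1 = r * (1 - (a * b) ^+ i.+1).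
  by apply: (mulfI ab1); rewrite /X pleth_h_M /r mulrA mulrCA divff // mulr1.
pose u s := scale (fun=> eps) (hsym (N - s)) * scale (fun=> - eps) (hsym s).
have coefE i : (shift al (scale (fun=> eps) (hsym N)))`_i =
    if (i <= N)%N then X i *: scale (fun=> eps) (hsym (N - i)) else 0.
  rewrite coef_shift_h; have -> // :
    pleth (A := Kqt) idfun (fun k => eps * al k) (hsym i) = X i.
  by apply: pleth_ext => k; rewrite /al mulrA eps2 mul1r.
have -> : vop eps a b (scale (fun=> eps) (hsym N)) = \sum_(s < N.+1) X s *: u s.
  rewrite /vop /vertex (@vcoefEw _ _ N.+1).
    apply: eq_bigr => s _; rewrite [X in X * _]coefE.
    by rewrite leq_ord /= subn0 /u scalerAl.
  apply/leq_sizeP => i lt_Ni; rewrite [LHS]coefE.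
  by rewrite leqNgt lt_Ni.
rewrite (sum_geometric_diff u N X0 XS).
have -> : u 0%N = scale (fun=> eps) (hsym N) by rewrite /u subn0 hsym0 rmorph1
  mulr1.
rewrite -/r -scalerN; congr (_ + _ *: _).
have flip (g g' : nat -> Kqt) : scale (fun k => g k + g' k) (hsym N) =
    \sum_(s < N.+1) scale g (hsym (N - s)) * scale g' (hsym s).
  rewrite -(@scale_ext (fun k => g' k + g k)) => [|k]; last exact: addrC.
  by rewrite scale_hD; apply: eq_bigr => s _; apply: mulrC.
have -> : \sum_(s < N.+1) u s = 0.
  rewrite -flip -(@scale_ext (fun=> 0)) => [|k]; last by rewrite subrr.
  by rewrite scale_h_zero.
rewrite sub0r; congr (- _).
rewrite -(@scale_ext (fun k => eps + (a * b) ^+ k * - eps)) => [|k]; last first.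
  by rewrite mulrN mulrBr mulr1 mulrC.
rewrite flip; apply: eq_bigr => s _.
by rewrite scale_hM scalerAr.
Qed.

Definition cells (mu : seq nat) : seq Kqt :=
  [seq t ^+ i * q ^+ j | i <- iota 0 (size mu), j <- iota 0 (nth 0%N mu i)].

Lemma big_iota (R : Type) (idx : R) (op : Monoid.law idx) n (F : nat -> R) :
  \big[op/idx]_(i <- iota 0 n) F i = \big[op/idx]_(i < n) F i.
Proof. by rewrite -[n in iota 0 n]subn0 -/(index_iota 0 n) big_mkord. Qed.

Lemma powersums_cells mu k : powersums (cells mu) k = B mu (q ^+ k) (t ^+ k).
Proof.
rewrite /powersums /cells big_allpairs_dep /= big_iota; apply: eq_bigr => i _.
rewrite big_iota; apply: eq_bigr => j _.
by rewrite exprMn -!exprM ![(_ * k)%N]mulnC.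
Qed.

Lemma sum_cellsV mu : \sum_(c <- cells mu) c^-1 = B mu q^-1 t^-1.
Proof.
rewrite /cells big_allpairs_dep /= big_iota; apply: eq_bigr => i _.
by rewrite big_iota; apply: eq_bigr => j _; rewrite invfM !exprVn.
Qed.

Lemma sum_nth (R : Type) (idx : R) (op : Monoid.law idx) (mu : seq nat) (F :
  nat -> R) :
  \big[op/idx]_(i < size mu) F (nth 0%N mu i) = \big[op/idx]_(m <- mu) F m.
Proof. by rewrite (big_nth 0%N) big_mkord. Qed.

Lemma size_cells mu : size (cells mu) = sumn mu.
Proof.
rewrite /cells size_allpairs_dep sumnE big_map big_iota sumnE.
by rewrite -(sum_nth _ mu id); apply: eq_bigr => i _; rewrite size_iota.
Qed.

Lemma npart_conj (mu : intpart) :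
  npart (conj_parts mu) = (\sum_(m <- mu) \sum_(j < m) j)%N.
Proof.
rewrite /npart size_map size_iota.
have E (j : nat) : (j * nth 0 (conj_parts mu) j)%N =
    (\sum_(m <- mu) if j < m then j else 0)%N.
  rewrite nth_conj ?partsP_sorted // -sum1_count big_distrr /= big_mkcond.
  by apply: eq_bigr => m _; rewrite muln1.
rewrite (eq_bigr _ (fun j _ => E (nat_of_ord j))).
rewrite exchange_big /=; apply: eq_big_seq => m m_mu.
have le_m : (m <= head 0 mu)%N.
  have smu := partsP_sorted mu; case: (parts mu) smu m_mu => // x s /= ps.
  rewrite inE => /predU1P[->//|ms].
  exact: (allP (order_path_min geq_trans ps) _ ms).
by rewrite (big_ord_widen _ (fun j => j) le_m) [RHS]big_mkcond.
Qed.

Lemma prod_cells (mu : intpart) : \prod_(c <- cells mu) c = T mu.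
Proof.
rewrite /T npart_conj /npart /cells big_allpairs_dep /= big_iota.
rewrite -(sum_nth _ mu (fun m => \sum_(j < m) j)%N).
rewrite !expr_sum -big_split; apply: eq_bigr => i _ /=.
rewrite big_iota big_split /= prodr_const card_ord -exprM mulnC.
by rewrite -expr_sum.
Qed.

Lemma coef_prod_1DX (F : fieldType) (x : seq F) : all (fun c => c != 0) x ->
  let P := \prod_(c <- x) (1 + c%:P * 'X) in
  [/\ (size P <= (size x).+1)%N, P`_(size x) = \prod_(c <- x) c
    & forall n, size x = n.+1 ->
      P`_n = (\prod_(c <- x) c) * \sum_(c <- x) c^-1].
Proof.
elim: x => [_|c x IH] /=.
  by rewrite !big_nil size_poly1 coef1; split.
move=> /andP[c_neq0 /IH{IH}]; rewrite !big_cons.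
set P := \prod_(_ <- x) _ => -[size_P top sub].
have E i : ((1 + c%:P * 'X) * P)`_i =
  P`_i + c * (if i == 0%N then 0 else P`_i.-1).
  by rewrite mulrDl mul1r coefD -mulrA coefCM coefXM.
split.
- apply/leq_sizeP => i le_i; rewrite E !nth_default ?add0r.
  + by case: i le_i => // i _; rewrite mulr0.
  + by case: i le_i => // i /=; rewrite ltnS; apply: leq_trans.
  by apply: leq_trans size_P _; apply: ltnW.
- by rewrite E /= top nth_default ?add0r.
move=> n [<-]; rewrite E top [RHS]mulrDr [c * _ / c]mulrAC divff // mul1r
  -mulrA.
congr (_ + c * _); case sx: (size x) => [|m] /=; last exact: sub.
by rewrite (size0nil sx) !big_nil mulr0.
Qed.

Lemma pleth_e_pred (x : seq Kqt) n : all (fun c => c != 0) x -> size x = n.+1 ->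
  pleth (A := Kqt) idfun (powersums x) (e n) =
  (\prod_(c <- x) c) * \sum_(c <- x) c^-1.
Proof.
by move=> x_neq0 size_x; rewrite e_realize;
  have [_ _ ->] := coef_prod_1DX x_neq0.
Qed.

Lemma plethB_e1 mu : plethB (e 1) mu = B mu q t.
Proof.
rewrite /plethB pleth_e expr1 -[pleth _ _ _]mul1r.
by have := @pleth_hS Kqt idfun (fun k => - B mu (q ^+ k) (t ^+ k)) 0;
  rewrite big_ord1 pleth_h0 mulr1 => ->; rewrite mulN1r opprK !expr1.
Qed.

Lemma cells_neq0 mu : all (fun c => c != 0) (cells mu).
Proof.
apply/allP => _ /allpairsPdep[i [j [_ _ ->]]].
by apply: mulf_neq0; apply: expf_neq0; [apply: t_neq0 | apply: q_neq0].
Qed.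

Lemma plethB_e_pred (mu : intpart) n : sumn mu = n.+1 ->
  plethB (e n) mu = T mu * B mu q^-1 t^-1.
Proof.
move=> size_mu; rewrite -prod_cells -sum_cellsV.
have size_c : size (cells mu) = n.+1 by rewrite size_cells.
rewrite -(pleth_e_pred (cells_neq0 mu) size_c).
by apply: pleth_ext => k; rewrite powersums_cells.
Qed.

Lemma scale_hdeg g n :
  lspan (fun f => exists2 la, sumn la = n & f = hprod la) (scale g (hsym n)).
Proof.
pose hdeg n (f : Lam) := exists2 la, sumn la = n & f = hprod la.
have hdegM m k f f' : lspan (hdeg m) f -> lspan (hdeg k) f' ->
  lspan (hdeg (m + k)%N) (f * f').
  move=> fP f'P; rewrite mulrC;
    apply: lspan_trans (_ : lspan (fun v => lspan (hdeg (m + k)%N) v) _).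
    by [].
  apply: lspan_mull fP => _ [la sla ->]; rewrite mulrC.
  apply: lspan_mull f'P => _ [mu smu ->]; exists (la ++ mu).
    by rewrite sumn_cat sla smu.
  by rewrite /hprod big_cat.
have hdeg_h m : lspan (hdeg m) (hsym m).
  by apply: lspan_gen; exists [:: m]; rewrite /= ?addn0 // /hprod big_seq1.
have newton (g' : nat -> Kqt) m : (m.+1%:R : Kqt) *: scale g' (hsym m.+1) =
    \sum_(k < m.+1) (g' k.+1 *: psum k.+1) * scale g' (hsym (m - k)).
  rewrite -mul_malgC rmorph_nat; exact: pleth_hS.
have newton_p m : (m.+1%:R : Kqt) *: hsym m.+1 =
    \sum_(k < m) psum k.+1 * hsym (m - k) + psum m.+1.
  rewrite -[hsym m.+1]scale_unit newton big_ord_recr; apply: f_equal2.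
    by apply: eq_bigr => k _; rewrite scale1r scale_unit.
  by rewrite subnn hsym0 scale1r scale_unit mulr1.
have hdeg_p m : lspan (hdeg m.+1) (psum m.+1).
  elim/ltn_ind: m => m IH.
  have -> : psum m.+1 =
      m.+1%:R *: hsym m.+1 - \sum_(k < m) psum k.+1 * hsym (m - k).
    by rewrite newton_p [X in X - _]addrC addrK.
  apply: lspanD; first exact/lspanZ/hdeg_h.
  apply/lspanN/lspan_sum => k _.
  have -> : m.+1 = (k.+1 + (m - k))%N by rewrite addSn subnKC // ltnW.
  by apply: hdegM => //; apply: IH.
elim/ltn_ind: n => -[_|n IH].
  rewrite hsym0 rmorph1; apply: lspan_gen; exists [::] => //.
  by rewrite /hprod big_nil.
have -> : scale g (hsym n.+1) =
  (n.+1%:R)^-1 *: (n.+1%:R *: scale g (hsym n.+1)).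
  by rewrite scalerA mulVf ?natK_neq0 // scale1r.
apply: lspanZ; rewrite newton; apply: lspan_sum => k _.
have E : (k.+1 + (n - k))%N = n.+1 by rewrite addSn subnKC // leq_ord.
rewrite -/(hdeg n.+1) -[X in lspan (hdeg X)]E.
apply: hdegM; first exact/lspanZ/hdeg_p.
by apply: IH; rewrite ltnS leq_subr.
Qed.

Lemma pleth_scaleE c f :
  pleth_scale c f = scale (fun k => c (q ^+ k) (t ^+ k)) f.
Proof. by apply: pleth_ext => k; rewrite psumE. Qed.

Lemma subr1_neq0 (F : fieldType) (x : F) : x != 1 -> 1 - x != 0.
Proof. by move=> x1; rewrite subr_eq0 eq_sym. Qed.

Lemma subr1V_neq0 (F : fieldType) (x : F) : x != 1 -> 1 - x^-1 != 0.
Proof. by move=> x1; rewrite subr_eq0 eq_sym invr_eq1. Qed.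

Lemma q_neq1 : q != 1.
Proof. exact: q_exp_neq1 0. Qed.

Lemma t_neq1 : t != 1.
Proof. exact: t_exp_neq1 0. Qed.

Lemma qt_neq0 : q * t != 0.
Proof. by apply: mulf_neq0; [apply: q_neq0 | apply: t_neq0]. Qed.

Lemma frac_subV (F : fieldType) (x : F) : x != 0 -> x / (x - 1) = (1 - x^-1)^-1.
Proof.
by move=> x_neq0; rewrite -{1}[x]invrK -invfM mulrBr mulVf // mulr1.
Qed.

Lemma neg_exp_factor (F : fieldType) (x : F) n : x != 0 ->
  (- x) ^ (1 - n.+1%:Z) * (1 - x)^-1 = (-1) ^+ n.+1 * x^-1 ^+ n.+1 / (1 - x^-1).
Proof.
move=> x_neq0.
have -> : 1 - n.+1%:Z = - n%:Z by rewrite intS opprD addrA subrr add0r.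
rewrite -exprnN -[X in X ^- n]mulN1r exprMn invfM invr_sign -(frac_subV x_neq0)
  -[x - 1]opprB.
rewrite invrN !exprS -exprVn;
  move: ((-1) ^+ n) (x^-1 ^+ n) ((1 - x)^-1) => s y z.
by field.
Qed.

Lemma hprod_nil : hprod [::] = 1.
Proof. exact: big_nil. Qed.

(** * The operators on the modified Macdonald basis *)

Section ModifiedMacdonald.
Variable H : intpart -> Lam.
Hypothesis macH : is_modified_macdonald H.

Let gq k := 1 - q ^+ k.
Let gt k := 1 - t ^+ k.

Lemma macdonald_free : ifree H.
Proof. by case: macH => -[_]. Qed.

Lemma gqK f : scale (fun k => (gq k)^-1) (scale gq f) = f.
Proof. by apply: scaleK => k; rewrite subr_eq0 eq_sym q_exp_neq1. Qed.

Lemma gtK f : scale (fun k => (gt k)^-1) (scale gt f) = f.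
Proof. by apply: scaleK => k; rewrite subr_eq0 eq_sym t_exp_neq1. Qed.

Lemma macdonald_tri1 mu : ispan (above mu) hprod (scale gq (H mu)).
Proof.
case: macH => _ /(_ mu)/in_span_ispan tri _ _; rewrite pleth_scaleE in tri.
apply: ispan_trans tri => la dla; apply: ispan_sub (schur_ispan la) => nu dnu.
exact: dominates_trans dnu dla.
Qed.

Lemma macdonald_tri2 mu : ispan (above (conj mu)) hprod (scale gt (H mu)).
Proof.
case: macH => _ _ /(_ mu)/in_span_ispan tri _; rewrite pleth_scaleE in tri.
apply: ispan_trans tri => la dla; apply: ispan_sub (schur_ispan la) => nu dnu.
exact: dominates_trans dnu dla.
Qed.

Lemma vop_macdonald eps a b c1 c2 mu : eps * eps = 1 ->
  (forall k, gq k.+1 * c1 ^+ k.+1 = eps * (1 - a ^+ k.+1)) ->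
  (forall k, gt k.+1 * c2 ^+ k.+1 = eps * (1 - b ^+ k.+1)) ->
  vop eps a b (H mu) = (1 - (1 - a) * (1 - b) * B mu a b) *: H mu.
Proof.
move=> eps2 Ec1 Ec2; rewrite -mac_eigE.
apply: (modified_macdonald_eigen macdonald_free gqK gtK macdonald_tri1
  macdonald_tri2).
  by move=> f; apply: (scale_vop (c := c1)).
by move=> f; rewrite vop_sym; apply: (scale_vop (c := c2)).
Qed.

Lemma vop_plus mu : vop 1 q t (H mu) =
  (1 - (1 - q) * (1 - t) * B mu q t) *: H mu.
Proof.
by apply: (@vop_macdonald _ _ _ 1 1) => [|k|k];
  rewrite ?mulr1 // expr1n mulr1 mul1r.
Qed.

Lemma vop_minus mu : vop (-1) q^-1 t^-1 (H mu) =
  (1 - (1 - q^-1) * (1 - t^-1) * B mu q^-1 t^-1) *: H mu.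
Proof.
apply: (@vop_macdonald _ _ _ q^-1 t^-1) => [|k|k];
  first by rewrite mulrNN mulr1.
  rewrite /gq mulrBl mul1r -exprMn mulfV ?q_neq0 // expr1n; ring.
rewrite /gt mulrBl mul1r -exprMn mulfV ?t_neq0 // expr1n; ring.
Qed.

Lemma diff_lin (K : fieldType) (V : lmodType K) (r c : K) (v w f g : V) :
  r *: ((c *: v + f) - (c *: w + g)) = c *: (r *: (v - w)) + r *: (f - g).
Proof. by rewrite opprD addrACA -scalerBr scalerDr !scalerA [c * r]mulrC. Qed.

Lemma diff_eig (K : fieldType) (V : lmodType K) (m b : K) (v : V) : m != 0 ->
  m^-1 *: (v - (1 - m * b) *: v) = b *: v.
Proof.
move=> m_neq0; rewrite scalerBl scale1r opprB addrC subrK scalerA mulrA.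
by rewrite mulVf // mul1r.
Qed.

Lemma diff_diff (K : fieldType) (V : lmodType K) (m s y : K) (v w : V) :
  m != 0 ->
  (s / m) *: (v - (v - (m / y) *: w)) = (s / y) *: w.
Proof.
by move=> m_neq0; rewrite opprB addrC subrK scalerA mulrA mulfVK.
Qed.

Lemma vop_linear_eq eps a b (r : Kqt) (P : intpart -> Prop) (L : Lam -> Lam) f :
  L 0 = 0 -> (forall c f g, L (c *: f + g) = c *: L f + L g) ->
  (forall mu, P mu -> L (H mu) = r *: (H mu - vop eps a b (H mu))) ->
  ispan P H f -> L f = r *: (f - vop eps a b f).
Proof.
move=> L0 Llin LH; apply: (@lspan_eq_lin _ _ _ _ L (fun f =>
  r *: (f - vop eps a b f))).
- exact: L0.
- by rewrite /vop vertex0 subr0 scaler0.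
- exact: Llin.
- by move=> c f1 f2; rewrite /vop vertexD vertexZ diff_lin.
by move=> _ [mu Pmu ->]; apply: LH.
Qed.

Lemma one_macdonald : exists c, 1 = c *: H (to_part [::]).
Proof.
have : ispan (above (to_part [::])) H 1.
  apply: (ispan_unscale gqK); rewrite rmorph1 -hprod_nil -hprod_to_part.
  exact: hprod_ispan_scale macdonald_free gqK macdonald_tri1 _.
have above0 la : above (to_part [::]) la -> la = to_part [::].
  case=> sla _; apply: val_inj; case: la sla => -[|x s] //= /andP[_].
  by rewrite inE negb_or; case: x.
elim=> [|c v f [la /above0 -> ->] _ [d ->]]; first by exists 0; rewrite scale0r.
by exists (c + d); rewrite scalerDl.
Qed.

Lemma e_degree n : ispan (fun mu : intpart => sumn mu = n) H (e n).
Proof.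
apply: (ispan_unscale gqK); rewrite e_scale_h scaleZ scale_comp; apply: lspanZ.
apply: lspan_trans (scale_hdeg _ n) => _ [la sla ->].
rewrite -hprod_to_part.
have := hprod_ispan_scale macdonald_free gqK macdonald_tri1 (to_part la).
apply: ispan_sub => nu [snu _].
by have [spart _] := dominates_to_part (raised_refl la); rewrite snu spart.
Qed.

Variables nabla nablaV : {linear Lam -> Lam}.
Variable Delta : Lam -> {linear Lam -> Lam}.
Hypothesis nablaP : is_nabla H nabla.
Hypothesis nablaK : cancel nabla nablaV.
Hypothesis DeltaP : forall f : Lam, is_Delta H f (Delta f).

Lemma nablaV1 : nablaV 1 = 1.
Proof.
rewrite -[X in nablaV X](_ : nabla 1 = 1) ?nablaK //.
have [c ->] := one_macdonald; rewrite linearZ /= nablaP.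
have -> : T (to_part [::]) = 1; last by rewrite scale1r.
by rewrite /T /npart /= !big_ord0 mulr1.
Qed.

Lemma nablaV_signr n : nablaV ((-1) ^+ n) = (-1) ^+ n.
Proof.
by rewrite -signr_odd; case: odd; rewrite ?expr1 ?linearN /= ?expr0 nablaV1.
Qed.

Lemma Qsucc_signr n : Qsucc nabla nablaV n ((-1) ^+ n) = nabla (e n).
Proof.
rewrite /Qsucc nablaV_signr; congr (nabla _); rewrite /D /pleth_Mz.
rewrite (_ : pleth _ _ _ = ((-1) ^+ n)%:P);
  last by rewrite rmorphXn rmorphN1 rmorphXn rmorphN1.
rewrite size_polyC signr_eq0 big_ord1 coefC /= addn0 mulrA -exprMn mulrNN mulr1.
by rewrite expr1n mul1r.
Qed.

Let qt1 : 1 - q * t != 0.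
Proof. exact/subr1_neq0/qt_neq1. Qed.

Let W n := scale (fun k => 1 - (q * t) ^+ k) (hsym n).

Lemma Delta_e1_h n : Delta (e 1) (h n.+1) = (1 - q * t)^-1 *: W n.+1.
Proof.
pose m := (1 - q) * (1 - t).
have m_neq0 : m != 0.
  by apply: mulf_neq0; apply: subr1_neq0; [apply: q_neq1 | apply: t_neq1].
rewrite (@vop_linear_eq 1 q t m^-1 (fun=> True) (Delta (e 1))).
- have -> : h n.+1 = scale (fun=> 1) (hsym n.+1) by rewrite scale_unit hsymE.
  rewrite (vop_scale_h n (mulr1 1) qt1) -[m^-1]mul1r.
  rewrite (diff_diff _ _ _ _ m_neq0) mul1r /W.
  by rewrite (@scale_ext _ (fun k => 1 - (q * t) ^+ k)) => [|k]; rewrite ?mul1r.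
- exact: linear0.
- exact: linearP.
- by move=> mu _; rewrite DeltaP plethB_e1 vop_plus (diff_eig _ _ m_neq0).
by case: macH => -[sp _] _ _ _; apply: in_span_ispan.
Qed.

Lemma nablaV_Delta_e n : nablaV (Delta (e n) (e n.+1)) =
  ((-1) ^+ n.+1 * (q * t)^-1 ^+ n.+1 / (1 - (q * t)^-1)) *: W n.+1.
Proof.
pose x := q^-1 * t^-1; have xE : (q * t)^-1 = x by rewrite invfM.
pose m := (1 - q^-1) * (1 - t^-1).
have m_neq0 : m != 0.
  by apply: mulf_neq0; apply: subr1V_neq0; [apply: q_neq1 | apply: t_neq1].
have x1 : 1 - x != 0 by rewrite -xE; apply/subr1V_neq0/qt_neq1.
transitivity (m^-1 *: (e n.+1 - vop (-1) q^-1 t^-1 (e n.+1))).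
  apply: (@vop_linear_eq (-1) q^-1 t^-1 m^-1 (fun mu :
    intpart => sumn mu = n.+1)
           (nablaV \o Delta (e n))); last exact: e_degree.
  - by rewrite /= !linear0.
  - by move=> c f1 f2; rewrite /= !linearP.
  - move=> mu smu; rewrite /= DeltaP (plethB_e_pred smu) vop_minus (diff_eig _
    _ m_neq0).
    by rewrite mulrC -scalerA -nablaP linearZ /= nablaK.
have sgn : -1 * -1 = 1 :> Kqt by rewrite mulrNN mulr1.
rewrite e_scale_h vopZ (vop_scale_h n sgn x1).
rewrite -scalerBr scalerA [m^-1 * _]mulrC (diff_diff _ _ _ _ m_neq0).
have -> : scale (fun k => -1 * (1 - x ^+ k)) (hsym n.+1) = x ^+ n.+1 *: W n.+1.
  rewrite /W -scale_hM; apply: scale_ext => k.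
  have xqt : x * (q * t) = 1 by rewrite -xE; apply: mulVf qt_neq0.
  by rewrite mulN1r opprB [RHS]mulrBr mulr1 -exprMn xqt expr1n.
by rewrite xE scalerA mulrAC.
Qed.

Lemma Qdiag_signr n : Qdiag nabla nablaV n.+1 ((-1) ^+ n.+1) =
  ((-1) ^+ n.+1 * (q * t)^-1 ^+ n.+1 / (1 - (q * t)^-1)) *: nabla (W n.+1).
Proof.
rewrite /Qdiag nablaV_signr pleth_scaleE -hsymE.
have -> : scale (fun k => (1 - q ^+ k * t ^+ k) / (q ^+ k * t ^+ k)) (hsym
  n.+1) =
    (q * t)^-1 ^+ n.+1 *: W n.+1.
  rewrite /W -scale_hM; apply: scale_ext => k.
  by rewrite -exprMn exprVn mulrC.
have -> : (-1) ^+ n.+1 = ((-1) ^+ n.+1)%:MP :> Lam by rewrite rmorphXn rmorphN1.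
rewrite [X in nabla X]mulrC mul_malgC !linearZ /= !scalerA.
rewrite (_ : _ * _ * _ = (-1) ^+ n.+1 * (q * t)^-1 ^+ n.+1 / (1 - (q * t)^-1))
  //.
by rewrite -(frac_subV qt_neq0); ring.
Qed.
End ModifiedMacdonald.

Theorem theorem6p4 (H : intpart -> Lam)
    (nabla nablaV : {linear Lam -> Lam})
    (Delta : Lam -> {linear Lam -> Lam})
    (H_macdonald : is_modified_macdonald H)
    (nablaP : is_nabla H nabla)
    (nablaK : cancel nabla nablaV) (nablaVK : cancel nablaV nabla)
    (DeltaP : forall f : Lam, is_Delta H f (Delta f))
    (n : nat) (n_ge1 : (1 <= n)%N) :
  Qsucc nabla nablaV n ((-1) ^+ n) = nabla (e n) /\
  (Qdiag nabla nablaV n ((-1) ^+ n) =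
     (- (q * t)) ^ (1 - n%:Z) *: nabla (Delta (e 1) (h n)) /\
   (- (q * t)) ^ (1 - n%:Z) *: nabla (Delta (e 1) (h n)) =
     Delta (e n.-1) (e n)).
Proof.
case: n n_ge1 => [//|n _]; split.
  exact: (Qsucc_signr H_macdonald nablaP nablaK).
rewrite (Delta_e1_h H_macdonald DeltaP) linearZ /= scalerA.
rewrite (neg_exp_factor n qt_neq0).
split; first exact: (Qdiag_signr H_macdonald nablaP nablaK).
by rewrite -[RHS]nablaVK (nablaV_Delta_e H_macdonald nablaP nablaK DeltaP)
  linearZ.
Qed.
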